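(* Let $(X,d)$ be a conditional metric space. The following are equivalent: (i) $(X,d)$ is conditionally compact; (ii) $(X,d)$ is conditionally complete and conditionally totally bounded; (iii) $(X,d)$ is conditionally sequentially compact.
   Context: $\mathcal{A}$ is a complete Boolean algebra with $0\ne1$; $p(a)$ is the set of families $(a_i)$ with $\bigvee a_i=a$, $a_i\wedge a_j=0$ ($i\ne j$). Conditional sets $X=(X_a,\gamma_a)_{a\in\mathcal A}$ are families of sets with surjections $\gamma_a:X_1\to X_a$ ($X_0$ a singleton, $\gamma_1=\mathrm{id}$), consistent and stable (unique gluing $\sum a_ix_i$ over $(a_i)\in p(1)$). Conditional subsets living on $b$ are non-empty subsets of $X_b$ closed under gluing; they form under $\sqsubseteq$ a complete Boolean algebra with $\sqcup,\sqcap$, least element $\mathbf0$. Conditional functions are families $f_a:X_a\to Y_a$ with $f_a(ax)=af_1(x)$. $\mathbf{N}$ is the conditional set generated by $\mathbb N$ (elements $\sum a_in_i$, $(a_i)\in p(1)$, $n_i\in\mathbb N$, ordered piecewise). $\mathbf{R}$ denotes the conditional real numbers (the conditionally ordered field of equivalence classes of conditionally Cauchy sequences of conditional rationals), $\mathbf{R}_+=\{x\geqslant0\}$, $\mathbf{R}_{++}=\{x>0\}$ where $x>0$ means $x\geqslant0$ and $ax=a0$ only for $a=0$. A conditional metric is a conditional function $d:X\times X\to\mathbf R_+$ with $d(x,y)=0$ iff $x=y$, $d(x,y)=d(y,x)$, $d(x,z)\leqslant d(x,y)+d(y,z)$. $X$ carries the conditional topology generated by the base of balls $B_\varepsilon(x)=\{y\in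 X:d(x,y)<\varepsilon\}$, $x\in X$, $\varepsilon\in\mathbf R_{++}$ (a conditional topology: collection of conditional subsets containing $\mathbf0,X$, closed under gluing, finite $\sqcap$ and arbitrary $\sqcup$). A conditional sequence is a conditional function $\mathbf N\to X$, $n\mapsto x_n$; it conditionally converges to $x$ if for every conditional neighborhood $U$ of $x$ there is $n_0\in\mathbf{N}$ with $x_n\in U$ for all $n\geqslant n_0$; it is conditionally Cauchy if for every $\varepsilon\in\mathbf R_{++}$ there is $n_0$ with $d(x_n,x_m)\leqslant\varepsilon$ for $n,m\geqslant n_0$. A conditional cluster point of $(x_n)$ is $x$ such that for every conditional neighborhood $U$ of $x$ and every $n$ there is $m\geqslant n$ with $x_m\in U$. $(X,d)$ is conditionally complete if every conditional Cauchy sequence conditionally converges; conditionally sequentially compact if every conditional sequence has a conditional cluster point in $X$; conditionally totally bounded if for every $\varepsilon\in\mathbf R_{++}$ there is a conditionally finite family $(x_k)_{1\leqslant k\leqslant n}$ in $X$ ($n\in\mathbf N$) with $X\sqsubseteq\sqcup_{1\leqslant k\leqslant n}B_\varepsilon(x_k)$. Conditional compactness: every conditional family of conditionally open sets $(O^j)_{j\in J}$ with $X\sqsubseteq\sqcup_jO^j$ admits $(a_i)\in p(1)$ and finite $J^i\subseteq J_1$ with $a_iX\sqsubseteq\sqcup_{j\in J^i}(O^j\sqcap a_iX)$ for each $i$. *)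

(* Defs.v *)
From HB Require Import structures.
From mathcomp Require Import all_boot all_order all_algebra.
From mathcomp Require Import boolp classical_sets cardinality.

Set Implicit Arguments.
Unset Strict Implicit.
Unset Printing Implicit Defensive.

Import Order.Theory GRing.Theory Num.Theory.

Local Open Scope classical_set_scope.
Local Open Scope order_scope.

HB.mixin Record isCompleteBool (d : Order.disp_t) (T : Type)
    of Order.CTBDistrLattice d T := {
  csup : set T -> T;
  csup_ub : forall (S : set T) (a : T), S a -> a <= csup S;
  csup_le : forall (S : set T) (b : T), (forall a, S a -> a <= b) -> csup S <= b;
  bot_neq_top : (\bot : T) != \top
}.

#[short(type="completeBoolType")]
HB.structure Definition CompleteBool d :=
  { T of isCompleteBool d T & Order.CTBDistrLattice d T }.

(* [cpart b a] is (a_i) \in p(b); some a_i may be 0 *)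
Definition cpart d (A : completeBoolType d) (I : Type) (b : A) (a : I -> A) :=
  csup (range a) = b /\ forall i j, i <> j -> a i `&` a j = \bot.

Section BooleanAlgebra.
Context d (A : completeBoolType d).
Implicit Types (a b c : A) (S : set A).

Lemma neq0_le a b : a != \bot -> a <= b -> b != \bot.
Proof. by move=> a0 ab; apply: contra_neq a0 => b0; apply/eqP; rewrite -lex0 -b0. Qed.

Lemma csup_hit S c : c != \bot -> c <= csup S ->
  exists2 a, S a & c `&` a != \bot.
Proof.
move=> c0 cS; apply: contrapT => H.
move/negP: c0; apply; rewrite -(meetxC c) eq_le lexI lexx /= leIl andbT.
rewrite (le_trans cS) //; apply: csup_le => a Sa; rewrite -disj_leC meetC.
by apply/negP => /negP ca; apply: H; exists a.
Qed.

Lemma force_le a b :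
  (forall c, c != \bot -> c <= a -> exists2 e, e != \bot & (e <= c) && (e <= b)) ->
  a <= b.
Proof.
move=> H; rewrite -[b]complK -disj_leC; apply/negP => /negP ab.
have [e e0 /andP[ec eb]] := H _ ab (leIl _ _).
move/negP: e0; apply; rewrite -lex0 -(meetxC b) lexI eb /=.
exact: le_trans ec (leIr _ _).
Qed.

Lemma cpart_le I b (a : I -> A) i : cpart b a -> a i <= b.
Proof. by move=> [<- _]; apply: csup_ub; exists i. Qed.

Lemma cpart_hit I b (a : I -> A) c : cpart b a -> c != \bot -> c <= b ->
  exists2 i, c `&` a i != \bot & a i <= b.
Proof.
move=> pa c0 cb; move: (cb); rewrite -pa.1 => /(csup_hit c0)[_ [i _ <-] ci].
by exists i => //; rewrite pa.1 cpart_le.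
Qed.

Lemma cpart_uniq I b (a : I -> A) c i j : cpart b a -> c != \bot ->
  c <= a i -> c <= a j -> i = j.
Proof.
move=> [_ dis] c0 ci cj; apply: contrapT => /dis ij.
by move/negP: c0; apply; rewrite -lex0 -ij lexI ci cj.
Qed.

Lemma cpartP I b (a : I -> A) : (forall i, a i <= b) ->
  (forall c, c != \bot -> c <= b -> exists2 i, True & c `&` a i != \bot) ->
  (forall i j c, c != \bot -> c <= a i -> c <= a j -> i = j) -> cpart b a.
Proof.
move=> ab hit dis; split; last first.
  move=> i j ij; apply/eqP/negP => /negP c0; apply: ij.
  by apply: (dis i j _ c0); [exact: leIl | exact: leIr].
apply/eqP; rewrite eq_le; apply/andP; split.
  by apply: csup_le => _ [i _ <-].
apply: force_le => c c0 cb; have [i _ ci] := hit _ c0 cb.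
exists (c `&` a i) => //; rewrite leIl (le_trans (leIr _ _)) //.
by apply: csup_ub; exists i.
Qed.

Lemma refine_sup S : exists (I : Type) (a : I -> A),
  cpart (csup S) a /\ forall i, exists2 s, S s & a i <= s.
Proof.
pose P (M : set A) := (forall c, M c -> c != \bot /\ exists2 s, S s & c <= s) /\
  (forall c c', M c -> M c' -> c <> c' -> c `&` c' = \bot).
have [|M [[M1 M2] Mmax]] := @Zorn_bigcup A P.
  move=> F FP Ftot; split.
    by move=> c [N FN Nc]; exact: (FP _ FN).1.
  move=> c c' [N FN Nc] [N' FN' Nc'].
  have [NN'|N'N] := Ftot _ _ FN FN'.
    by apply: (FP _ FN').2 => //; apply: NN'.
  by apply: (FP _ FN).2 => //; apply: N'N.
exists {c | M c}, (fun c : {c | M c} => sval c); split; last by move=> [c Mc] /=; have [_] := M1 _ Mc.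
apply: cpartP.
- move=> [c Mc] /=; have [_ [s Ss /le_trans]] := M1 _ Mc; apply.
  exact: csup_ub.
- move=> c c0 cS; apply: contrapT => H.
  have cM m : M m -> c `&` m = \bot.
    move=> Mm; apply/eqP/negP => /negP cm; apply: H.
    by exists (exist _ m Mm).
  have [s Ss cs] := csup_hit c0 cS.
  have /Mmax : (M `<` (fun x => M x \/ x = (c `&` s)%O))%classic.
    split; first by move=> x; left.
    move=> /(_ (c `&` s)) /(_ (or_intror erefl)) /cM.
    by rewrite meetA meetxx => cs0; rewrite cs0 eqxx in cs.
  apply; split.
    move=> x [/M1//|->]; split => //; exists s => //; exact: leIr.
  have disj m : M m -> c `&` s `&` m = \bot.
    by move=> /cM cm; rewrite meetAC cm meet0x.
  move=> x y [Mx|->] [My|->] xy //; [exact: M2 | | exact: disj].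
  by rewrite meetC disj.
- move=> [m Mm] [m' Mm'] c c0 /= cm cm'; apply: eq_exist.
  apply: contrapT => /(M2 _ _ Mm Mm') mm'.
  by move/negP: c0; apply; rewrite -lex0 -mm' lexI cm cm'.
Qed.

Lemma cpart_bool a : cpart \top (fun i : bool => if i then a else ~` a).
Proof.
apply: cpartP => [i|c c0 _|]; first exact: lex1.
  have [ca|ca] := eqVneq (c `&` a) \bot; last by exists true.
  exists false => //; apply: contra_neq c0 => ca'.
  by rewrite -[c]meetx1 -(joinxC a) meetUr ca ca' joinx0.
have H c : c != \bot -> c <= a -> c <= ~` a -> False.
  by move=> /negP c0 ca ca'; apply: c0; rewrite -lex0 -(meetxC a) lexI ca.
by move=> [] [] c c0 // ca ca'; [case: (H c) | case: (H c)].
Qed.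

Lemma cpart_option I b (a : I -> A) e : cpart b a -> b <= e ->
  cpart e (fun i => if i is Some i then a i else e `&` ~` b).
Proof.
move=> pa be; apply: cpartP => [[i|]|c c0 ce|].
- exact: le_trans (cpart_le _ pa) be.
- exact: leIl.
- have [cb|cb] := eqVneq (c `&` b) \bot.
    exists None => //; have -> // : c `&` (e `&` ~` b) = c.
    by apply/meet_idPl; rewrite lexI ce -disj_leC cb eqxx.
  have [i ci _] := cpart_hit pa cb (leIr _ _); exists (Some i) => //.
  by apply: neq0_le ci _; rewrite leI2 // leIl.
- have H i c : c != \bot -> c <= a i -> c <= e `&` ~` b -> False.
    move=> /negP c0 ci cb; apply: c0; rewrite -lex0 -(meetxC b) lexI.
    by rewrite (le_trans ci (cpart_le _ pa)) (le_trans cb (leIr _ _)).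
  move=> [i|] [j|] c c0 // ci cj; first by rewrite (cpart_uniq pa c0 ci cj).
    by case: (H i c).
  by case: (H j c).
Qed.

Lemma cpart_meet I b (a : I -> A) c : cpart b a -> cpart (c `&` b) (fun i => c `&` a i).
Proof.
move=> pa; apply: cpartP => [i|e e0 ecb|].
- by rewrite leI2 // cpart_le.
- have [i ei _] := cpart_hit pa e0 (le_trans ecb (leIr _ _)); exists i => //.
  by rewrite meetA; have /meet_idPl -> : e <= c := le_trans ecb (leIl _ _).
- move=> i j e e0 ei ej; apply: (cpart_uniq pa e0).
    exact: le_trans ei (leIr _ _).
  exact: le_trans ej (leIr _ _).
Qed.

End BooleanAlgebra.

Record condSet d (A : completeBoolType d) := CondSet {
  carr :> A -> Type;
  gam : forall a, carr \top -> carr a;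
  gam_surj : forall a (y : carr a), exists x, gam a x = y;
  gam_top : forall x, gam \top x = x;
  carr_bot : exists x : carr \bot, forall y, y = x;
  gam_cons : forall a b x y, a <= b -> gam b x = gam b y -> gam a x = gam a y;
  gam_stab : forall (I : Type) (a : I -> A) (x : I -> carr \top), cpart \top a ->
    exists! z, forall i, gam (a i) z = gam (a i) (x i)
}.
Arguments gam {d A X} a x : rename.
Arguments gam_surj {d A X a} y : rename.
Arguments gam_top {d A X} x : rename.
Arguments gam_cons {d A X a b x y} : rename.
Arguments gam_stab {d A X I a} x : rename.

Record condFun d (A : completeBoolType d) (X Y : condSet A) := CondFun {
  cfun : forall a, X a -> Y a;
  cfunE : forall a x, cfun (gam a x) = gam a (cfun x)
}.

(* A conditional function applied to a conditional element x \in X_1. *)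
Definition capp d (A : completeBoolType d) (X Y : condSet A) (f : condFun X Y)
  : X \top -> Y \top := @cfun _ _ _ _ f \top.
Coercion capp : condFun >-> Funclass.

Section CondSetTheory.
Context d (A : completeBoolType d) (X : condSet A).
Implicit Types (a b c : A) (x y z : X \top).

Definition clift b (y : X b) : X \top := sval (cid (gam_surj y)).

Lemma cliftK b (y : X b) : gam b (clift y) = y.
Proof. exact: (svalP (cid (gam_surj y))). Qed.

Lemma clift_top x : clift x = x.
Proof. by rewrite -[LHS]gam_top cliftK. Qed.

(* For a <= b this is the map X_b -> X_a, independent of the clift by
   consistency; the value is irrelevant otherwise. *)
Definition cres b a (y : X b) : X a := gam a (clift y).

Lemma cres_gam a b x : a <= b -> cres a (gam b x) = gam a x.
Proof. by move=> ab; apply: (gam_cons ab); rewrite cliftK. Qed.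

Lemma gam_bot x y : gam \bot x = gam \bot y.
Proof. by have [z zP] := carr_bot X; rewrite (zP (gam _ x)) (zP (gam _ y)). Qed.

Lemma mix a x y : exists z, gam a z = gam a x /\ gam (~` a) z = gam (~` a) y.
Proof.
have [z [zP _]] := gam_stab (fun i : bool => if i then x else y) (cpart_bool a).
by exists z; split; [exact: (zP true) | exact: (zP false)].
Qed.

Lemma glue_exists I b (a : I -> A) (x : I -> X \top) : cpart b a ->
  exists z, forall i, gam (a i) z = gam (a i) (x i).
Proof.
move=> pa; have [e _] := carr_bot X; pose x0 := clift e.
have [z [zP _]] :=
  gam_stab (fun i => if i is Some i then x i else x0) (cpart_option pa (lex1 _)).
by exists z => i; apply: (zP (Some i)).
Qed.

Lemma gam_eq I b (a : I -> A) x y : cpart b a ->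
  (forall i, gam (a i) x = gam (a i) y) -> gam b x = gam b y.
Proof.
move=> pa xy; have [z [zx zy]] := mix b x y; rewrite -zx; congr gam.
have [w [_ wP]] := gam_stab (fun=> y) (cpart_option pa (lex1 b)).
transitivity w; last by apply: wP.
apply/esym/wP => -[i|]; last by rewrite meet1x.
by rewrite -xy; apply: gam_cons (cpart_le i pa) zx.
Qed.

Lemma gam_eqT I (a : I -> A) x y : cpart \top a ->
  (forall i, gam (a i) x = gam (a i) y) -> x = y.
Proof. by move=> pa /(gam_eq pa); rewrite !gam_top. Qed.

End CondSetTheory.

Section CondFunTheory.
Context d (A : completeBoolType d) (X Y : condSet A).

Lemma gam_capp (f : condFun X Y) a x y : gam a x = gam a y -> gam a (f x) = gam a (f y).
Proof. by move=> xy; rewrite -!cfunE xy. Qed.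

Section Make.
Variable f : X \top -> Y \top.
Hypothesis fP : forall a x y, gam a x = gam a y -> gam a (f x) = gam a (f y).

Definition condfun_of : condFun X Y.
Proof.
exists (fun a x => gam a (f (clift x))) => a x.
by rewrite gam_top clift_top; apply: fP; rewrite cliftK.
Defined.

Lemma condfun_ofE x : condfun_of x = f x.
Proof. by rewrite /condfun_of /capp /= gam_top clift_top. Qed.
End Make.
End CondFunTheory.

Section Product.
Context d (A : completeBoolType d) (X Y : condSet A).

Definition prodC : condSet A.
Proof.
exists (fun a => X a * Y a)%type (fun a z => (gam a z.1, gam a z.2)).
- by move=> a [x y]; exists (clift x, clift y); rewrite /= !cliftK.
- by move=> [x y]; rewrite !gam_top.
- have [x xP] := carr_bot X; have [y yP] := carr_bot Y.
  by exists (x, y) => -[u v]; rewrite (xP u) (yP v).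
- by move=> a b [x y] [x' y'] ab /= [xx yy]; congr pair; apply: gam_cons ab _.
- move=> I a z pa.
  have [x xP] := glue_exists (fun i => (z i).1) pa.
  have [y yP] := glue_exists (fun i => (z i).2) pa.
  exists (x, y); split => [i|[u v] uv]; first by rewrite /= xP yP.
  by congr pair; apply: (gam_eqT pa) => i; [rewrite xP | rewrite yP]; case: (uv i).
Defined.
End Product.

(* A non-empty set of elements of X closed under gluing over p(1), i.e. a
   conditional subset living on 1, seen as a conditional set. *)
Section SubC.
Context d (A : completeBoolType d) (X : condSet A).

Definition stable (P : set (X \top)) := forall (I : Type) (a : I -> A)
  (y : I -> X \top) z, cpart \top a -> (forall i, P (y i)) ->
  (forall i, gam (a i) z = gam (a i) (y i)) -> P z.

Variables (P : set (X \top)) (P0 : exists x, P x) (Pst : stable P).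

Definition subC_in a z (Pz : P z) : {y : X a | exists2 z, P z & gam a z = y} :=
  exist _ (gam a z) (ex_intro2 _ _ z Pz erefl).

Definition subC_gam a (x : {x : X \top | exists2 z, P z & gam \top z = x}) :
  {y : X a | exists2 z, P z & gam a z = y}.
Proof.
exists (gam a (sval x)); case: x => x [z Pz zx]; exists z => //=.
by rewrite -zx gam_top.
Defined.

Definition subC : condSet A.
Proof.
exists (fun a => {y : X a | exists2 z, P z & gam a z = y}) subC_gam.
- move=> a [y [z Pz zy]].
  by exists (subC_in \top Pz); apply: eq_exist; rewrite /= gam_top.
- by move=> [x xP]; apply: eq_exist; rewrite /= gam_top.
- have [z Pz] := P0.
  exists (subC_in \bot Pz) => -[y [w Pw wy]]; apply: eq_exist.
  by rewrite -wy; apply: gam_bot.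
- move=> a b [x xP] [y yP] ab /(congr1 sval) /= xy; apply: eq_exist => /=.
  exact: gam_cons ab xy.
- move=> I a x pa; have [z zP] := glue_exists (fun i => sval (x i)) pa.
  have Pz : P z.
    apply: (Pst pa _ zP) => i; case: (x i) => w [v Pv /= <-].
    by rewrite gam_top.
  exists (subC_in \top Pz); split => [i|[w wP] wx]; apply: eq_exist => /=.
    by rewrite gam_top zP.
  rewrite gam_top; apply: (gam_eqT pa) => i; rewrite zP.
  by move: (congr1 sval (wx i)).
Defined.
End SubC.

(* A family of equivalence relations E_a, compatible with restriction and
   gluing, yields the conditional set of classes X_a = S / E_a. *)
Section Quotient.
Context d (A : completeBoolType d) (S : Type) (E : A -> S -> S -> Prop).
Hypotheses (Erefl : forall a x, E a x x)
  (Esym : forall a x y, E a x y -> E a y x)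
  (Etrans : forall a x y z, E a x y -> E a y z -> E a x z)
  (Ele : forall a b x y, a <= b -> E b x y -> E a x y)
  (Ebot : forall x y, E \bot x y)
  (Eloc : forall (I : Type) (a : I -> A) x y, cpart \top a ->
    (forall i, E (a i) x y) -> E \top x y)
  (Eglue : forall (I : Type) (a : I -> A) (x : I -> S), cpart \top a ->
    exists z, forall i, E (a i) z (x i)).
Hypothesis (S0 : S).

Definition qclass a x : {C : set S | exists x, C = E a x} :=
  exist _ (E a x) (ex_intro _ x erefl).

Definition qrepr a (C : {C : set S | exists x, C = E a x}) : S := sval (cid (svalP C)).

Lemma qclass_eq a x y : qclass a x = qclass a y <-> E a x y.
Proof.
split=> [/(congr1 sval) /= xy|xy]; first by rewrite xy; apply: Erefl.
apply: eq_exist; apply/funext => z; apply/propext; split=> h.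
  exact: Etrans (Esym xy) h.
exact: Etrans xy h.
Qed.

Lemma qreprK a C : qclass a (qrepr C) = C.
Proof.
case: C => C CP; apply: eq_exist.
by rewrite /qrepr; case: cid => x /= ->.
Qed.

Lemma qrepr_qclass a x : E a (qrepr (qclass a x)) x.
Proof. by apply/qclass_eq; rewrite qreprK. Qed.

Definition quotC : condSet A.
Proof.
exists (fun a => {C : set S | exists x, C = E a x}) (fun a C => qclass a (qrepr C)).
- move=> a C; exists (qclass \top (qrepr C)); rewrite -[RHS]qreprK.
  by apply/qclass_eq; apply: Ele (lex1 a) (qrepr_qclass _ _).
- exact: qreprK.
- exists (qclass \bot S0) => C; rewrite -[LHS]qreprK; exact/qclass_eq.
- by move=> a b x y ab /qclass_eq xy; apply/qclass_eq; apply: Ele ab xy.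
- move=> I a x pa; have [z zP] := Eglue (fun i => qrepr (x i)) pa.
  exists (qclass \top z); split=> [i|C CP].
    apply/qclass_eq; apply: Etrans _ (zP i).
    by apply: Ele (lex1 _) (qrepr_qclass _ _).
  rewrite -[RHS]qreprK; apply/qclass_eq/(Eloc pa) => i.
  by apply: Etrans (zP i) _; apply/Esym/qclass_eq.
Defined.

Lemma quotC_gamE a x : gam (X := quotC) a (qclass \top x) = qclass a x.
Proof. by apply/qclass_eq; apply: Ele (lex1 a) (qrepr_qclass _ _). Qed.
End Quotient.

Section Generated.
Context d (A : completeBoolType d).
Implicit Types (a b c : A).

Lemma csup_force (S : set A) c : c != \bot -> c <= csup S ->
  exists s e, [/\ S s, e != \bot, e <= c & e <= s].
Proof.
by move=> c0 /(csup_hit c0)[s Ss cs]; exists s, (c `&` s); rewrite leIl leIr.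
Qed.

Lemma cpart_force I b (a : I -> A) c : cpart b a -> c != \bot -> c <= b ->
  exists i e, [/\ e != \bot, e <= c & e <= a i].
Proof.
move=> pa c0 cb; have [i ci _] := cpart_hit pa c0 cb.
by exists i, (c `&` a i); rewrite leIl leIr.
Qed.

Variables (E : eqType) (e0 : E).

(* The formal sum of the a_i e_i is identified with the function f that maps e
   to the join of the a_i such that e_i = e. *)
Definition gen_gam a (f : {f : E -> A | cpart \top f}) : {f : E -> A | cpart a f}.
Proof.
exists (fun e => a `&` sval f e).
by rewrite -[X in cpart X _]meetx1; apply/cpart_meet/(svalP f).
Defined.

Lemma gen_eqP a f g : gen_gam a f = gen_gam a g <->
  forall c p, c != \bot -> c <= a -> c <= sval f p -> c <= sval g p.
Proof.
split=> [/(congr1 sval)/= fg c p c0 ca cf|H].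
  by have /= := congr1 (fun h => c <= h p) fg; rewrite !lexI ca cf /= => <-.
apply: eq_exist; apply/funext => p /=; apply/eqP; rewrite eq_le; apply/andP; split.
  by rewrite lexI leIl; apply: force_le => c c0; rewrite lexI => /andP[ca cf];
     exists c => //; rewrite lexx; apply: H.
rewrite lexI leIl; apply: force_le => c c0; rewrite lexI => /andP[ca cg].
have [q [e [en ec eq]]] := cpart_force (svalP f) c0 (lex1 _).
exists e => //; rewrite ec /=; suff -> : p = q by [].
apply: (cpart_uniq (svalP g) en); first exact: le_trans ec cg.
by apply: H => //; apply: le_trans ec ca.
Qed.

Definition gen_const (e : E) : {f : E -> A | cpart \top f}.
Proof.
exists (fun e' => if e' == e then \top else \bot); apply: cpartP => [i|c c0 _|].
- exact: lex1.
- by exists e => //; rewrite eqxx meetx1.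
- move=> i j c c0; case: eqP => [->|_ c0']; last by rewrite -lex0 c0' in c0.
  by case: eqP => [->//|_ _ c0']; rewrite -lex0 c0' in c0.
Defined.

Definition gen : condSet A.
Proof.
exists (fun a => {f : E -> A | cpart a f}) gen_gam.
- move=> a [f fP].
  have gP : cpart \top (fun e => f e `|` (~` a `&` (if e == e0 then \top else \bot))).
    apply: cpartP => [i|c c0 _|]; first exact: lex1.
      have [ca|ca] := eqVneq (c `&` a) \bot.
        exists e0 => //; rewrite eqxx meetx1 meetUr.
        apply: neq0_le c0 (le_trans _ (leUr _ _)).
        by rewrite lexI lexx -disj_leC ca eqxx.
      have [e [x [x0 xc xf]]] := cpart_force fP ca (leIr _ _).
      exists e => //; apply: neq0_le x0 _.
      by rewrite lexI (le_trans xc (leIl _ _)) lexUl.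
    move=> i j c c0 ci cj.
    have [ca|ca] := eqVneq (c `&` a) \bot.
      have cna : c <= ~` a by rewrite -disj_leC ca eqxx.
      have H k : c <= f k `|` (~` a `&` (if k == e0 then \top else \bot)) -> k = e0.
        case: (k =P e0) => // _; rewrite meetx0 joinx0 => cf.
        move/negP: c0; case; rewrite -lex0 -ca lexI lexx.
        exact: le_trans cf (cpart_le _ fP).
      by rewrite (H i ci) (H j cj).
    have H k : c <= f k `|` (~` a `&` (if k == e0 then \top else \bot)) ->
        c `&` a <= f k.
      move=> ck; have: c `&` a <= a `&` (f k `|` (~` a `&` (if k == e0 then \top else \bot))).
        by rewrite lexI leIr (le_trans (leIl _ _) ck).
      by rewrite meetUr meetA meetxC meet0x joinx0 => /le_trans; apply; apply: leIr.
    exact: (cpart_uniq fP ca (H i ci) (H j cj)).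
  exists (exist _ _ gP); apply: eq_exist; apply/funext => e /=.
  rewrite meetUr meetA meetxC meet0x joinx0; apply/meet_idPr.
  exact: cpart_le fP.
- by move=> [f fP]; apply: eq_exist; apply/funext => e /=; rewrite meet1x.
- exists (gen_gam \bot (gen_const e0)) => -[f fP]; apply: eq_exist.
  apply/funext => e /=; rewrite meet0x; apply/eqP; rewrite -lex0.
  exact: cpart_le fP.
- move=> a b f g ab /gen_eqP H; apply/gen_eqP => c p c0 ca.
  by apply: H => //; apply: le_trans ca ab.
- move=> I a f pa.
  pose S e := (fun x => exists2 i, True & x = a i `&` sval (f i) e) : set A.
  have hP : cpart \top (fun e => csup (S e)).
    apply: cpartP => [i|c c0 _|]; first exact: lex1.
      have [i [x [x0 xc xa]]] := cpart_force pa c0 (lex1 _).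
      have [e [y [y0 yx yf]]] := cpart_force (svalP (f i)) x0 (lex1 _).
      exists e => //; apply: neq0_le y0 _; rewrite lexI (le_trans yx xc) /=.
      apply: (@le_trans _ _ (a i `&` sval (f i) e)); last by apply: csup_ub; exists i.
      by rewrite lexI yf (le_trans yx xa).
    move=> p q c c0 /(csup_force c0)[_ [x [[i _ ->] x0 xc]]].
    rewrite lexI => /andP[xi xp] cq.
    have [_ [y [[j _ ->] y0 yx]]] := csup_force x0 (le_trans xc cq).
    rewrite lexI => /andP[yj yq].
    have ij := cpart_uniq pa y0 (le_trans yx xi) yj; rewrite -ij in yq.
    exact: (cpart_uniq (svalP (f i)) y0 (le_trans yx xp) yq).
  have hE i : gen_gam (a i) (exist _ _ hP) = gen_gam (a i) (f i).
    apply/esym/gen_eqP => c p c0 ca cf /=.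
    apply: (@le_trans _ _ (a i `&` sval (f i) p)); last by apply: csup_ub; exists i.
    by rewrite lexI ca.
  exists (exist _ _ hP); split => // -[g gP] gE; apply: eq_exist; apply/funext => e.
  have gh i : gen_gam (a i) (exist _ _ hP) = gen_gam (a i) (exist _ g gP) by rewrite gE hE.
  apply/eqP; rewrite eq_le; apply/andP; split; apply: force_le => c c0 ce;
    have [i [x [x0 xc xa]]] := cpart_force pa c0 (lex1 _); exists x => //;
    rewrite xc /=.
    by have /gen_eqP := gh i; apply=> //; apply: le_trans xc ce.
  by have /esym/gen_eqP := gh i; apply=> //; apply: le_trans xc ce.
Defined.

End Generated.

Section GeneratedTheory.
Context d (A : completeBoolType d).
Implicit Types (a b c : A).

Section One.
Context (E : eqType) (e0 : E).
Local Notation G := (gen A e0).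

Definition gval (f : G \top) : E -> A := sval f.

Lemma gval_part (f : G \top) : cpart \top (gval f).
Proof. exact: svalP f. Qed.

Lemma gval_force (f : G \top) c : c != \bot ->
  exists p e, [/\ e != \bot, e <= c & e <= gval f p].
Proof. by move=> c0; apply: cpart_force (gval_part f) c0 (lex1 _). Qed.

Lemma gval_uniq (f : G \top) c p q : c != \bot -> c <= gval f p -> c <= gval f q -> p = q.
Proof. exact: cpart_uniq (gval_part f). Qed.

Lemma gen_gamP a (f g : G \top) : gam a f = gam a g <->
  forall c p, c != \bot -> c <= a -> c <= gval f p -> c <= gval g p.
Proof. exact: gen_eqP. Qed.

Lemma gam_gval a (f g : G \top) c p :
  gam a f = gam a g -> c != \bot -> c <= a -> c <= gval f p -> c <= gval g p.
Proof. by move=> /gen_gamP; apply. Qed.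

Definition gconst (e : E) : G \top := gen_const A e.

Lemma gconstE e c p : c != \bot -> (c <= gval (gconst e) p) = (p == e).
Proof.
move=> c0; rewrite /gval /=; case: (p == e); first exact: lex1.
by rewrite lex0; apply/negbTE.
Qed.
End One.

Section Two.
Context (E F H : eqType) (e0 : E) (f0 : F) (h0 : H).

(* a (sum a_i p_i) r a (sum b_j q_j), piecewise *)
Definition grel_on (r : E -> F -> Prop) a (f : gen A e0 \top) (g : gen A f0 \top) :=
  forall p q, a `&` (gval f p `&` gval g q) != \bot -> r p q.

Lemma grel_onP r a f g : grel_on r a f g <-> forall c p q, c != \bot -> c <= a ->
  c <= gval f p -> c <= gval g q -> r p q.
Proof.
split=> [R c p q c0 ca cp cq|R p q pq].
  by apply: R; apply: neq0_le c0 _; rewrite !lexI ca cp cq.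
apply: (R _ p q pq); first exact: leIl.
  exact: le_trans (leIr _ _) (leIl _ _).
exact: le_trans (leIr _ _) (leIr _ _).
Qed.

Definition glift2 (op : E -> F -> H) (f : gen A e0 \top) (g : gen A f0 \top) :
  gen A h0 \top.
Proof.
exists (fun r => csup (fun x => exists p q, op p q = r /\ x = gval f p `&` gval g q)).
apply: cpartP => [r|c c0 _|]; first exact: lex1.
  have [p [x [x0 xc xp]]] := gval_force f c0.
  have [q [y [y0 yx yq]]] := gval_force g x0.
  exists (op p q) => //; apply: neq0_le y0 _; rewrite lexI (le_trans yx xc) /=.
  apply: (@le_trans _ _ (gval f p `&` gval g q)).
    by rewrite lexI yq (le_trans yx xp).
  by apply: csup_ub; exists p, q.
move=> r r' c c0 /(csup_force c0)[_ [x [[p [q [<- ->]] x0 xc]]]].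
rewrite lexI => /andP[xp xq] cr'.
have [_ [y [[p' [q' [<- ->]]] y0 yx]]] := csup_force x0 (le_trans xc cr').
rewrite lexI => /andP[yp' yq'].
by rewrite (gval_uniq y0 (le_trans yx xp) yp') (gval_uniq y0 (le_trans yx xq) yq').
Defined.

Lemma glift2_in op f g c p q : c <= gval f p -> c <= gval g q ->
  c <= gval (glift2 op f g) (op p q).
Proof.
move=> cp cq; apply: (@le_trans _ _ (gval f p `&` gval g q)); first by rewrite lexI cp.
by apply: csup_ub; exists p, q.
Qed.

Lemma glift2_force op f g c r : c != \bot -> c <= gval (glift2 op f g) r ->
  exists p q e, [/\ e != \bot, e <= c, e <= gval f p, e <= gval g q & op p q = r].
Proof.
move=> c0 /(csup_force c0)[_ [x [[p [q [<- ->]]] x0 xc]]].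
by rewrite lexI => /andP[xp xq]; exists p, q, x.
Qed.

Lemma grel_on_gam r a f g f' g' : gam a f = gam a f' -> gam a g = gam a g' ->
  grel_on r a f g -> grel_on r a f' g'.
Proof.
move=> ff gg /grel_onP R; apply/grel_onP => c p q c0 ca cp cq; apply: (R c) => //.
  exact: gam_gval (esym ff) c0 ca cp.
exact: gam_gval (esym gg) c0 ca cq.
Qed.

Lemma grel_on_le r a b f g : a <= b -> grel_on r b f g -> grel_on r a f g.
Proof.
move=> ab /grel_onP R; apply/grel_onP => c p q c0 ca; apply: R => //.
exact: le_trans ca ab.
Qed.

Lemma grel_on_glue r I b (a : I -> A) f g : cpart b a ->
  (forall i, grel_on r (a i) f g) -> grel_on r b f g.
Proof.
move=> pa R; apply/grel_onP => c p q c0 cb cp cq.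
have [i [x [x0 xc xa]]] := cpart_force pa c0 cb.
have /grel_onP := R i; apply; [exact: x0 | exact: xa | |]; exact: le_trans xc _.
Qed.

End Two.

Lemma glift2_gam (E F H : eqType) (e0 : E) (f0 : F) (h0 : H) op a
    (f f' : gen A e0 \top) (g g' : gen A f0 \top) :
  gam a f = gam a f' -> gam a g = gam a g' ->
  gam a (glift2 h0 op f g) = gam a (glift2 h0 op f' g').
Proof.
move=> ff gg; apply/gen_gamP => c r c0 ca cr; apply: force_le => x x0 xc.
have [p [q [y [y0 yx yp yq <-]]]] := glift2_force x0 (le_trans xc cr).
have ya := le_trans yx (le_trans xc ca).
exists y => //; rewrite yx andTb; apply: glift2_in.
  exact: gam_gval ff y0 ya yp.
exact: gam_gval gg y0 ya yq.
Qed.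

End GeneratedTheory.

Definition cstrict d (A : completeBoolType d) (X : condSet A)
    (le : X \top -> X \top -> Prop) (x y : X \top) :=
  le x y /\ forall a, gam a x = gam a y -> a = \bot.

Section Numbers.
Context d (A : completeBoolType d).
Implicit Types (a b c : A).

(* Elements of the conditional sets N, Q, R below are the points over \top. *)
Definition condN : condSet A := @gen d A nat 0%N.
Definition condQ : condSet A := @gen d A rat 0%R.

Definition Nle (m n : condN \top) := grel_on (fun i j : nat => (i <= j)%N) \top m n.

(* a f <= a g *)
Definition Qle_on a (f g : condQ \top) := grel_on (fun p q : rat => (p <= q)%R) a f g.
Definition Qle := Qle_on \top.
Definition Qpos (e : condQ \top) := cstrict Qle (gconst A 0%R 0%R) e.
Definition Qadd (f g : condQ \top) : condQ \top := glift2 0%R (fun p q : rat => p + q)%R f g.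
Definition Qdist (f g : condQ \top) : condQ \top :=
  glift2 0%R (fun p q : rat => `|p - q|)%R f g.

Definition is_cauchyQ (s : condFun condN condQ) :=
  forall e, Qpos e -> exists n0, forall n m, Nle n0 n -> Nle n0 m ->
    Qle (Qdist (s n) (s m)) e.

Record cauchyQ := CauchyQ { cseq :> condFun condN condQ; cseqP : is_cauchyQ cseq }.

Implicit Types (s t u : cauchyQ) (e : condQ \top) (n m k : condN \top).

(* as = at as conditional reals: the equivalence defining R *)
Definition cauchy_eq a s t := forall e, Qpos e ->
  exists n0, forall n, Nle n0 n -> Qle_on a (Qdist (s n) (t n)) e.

(* as <= at as conditional reals *)
Definition cauchy_le a s t := forall e, Qpos e ->
  exists n0, forall n, Nle n0 n -> Qle_on a (s n) (Qadd (t n) e).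

Lemma Qpos_gt0 e c p : Qpos e -> c != \bot -> c <= gval e p -> (0 < p)%R.
Proof.
move=> [/grel_onP e0 e1] c0 cp; rewrite lt_neqAle; apply/andP; split.
  apply: contra_neq c0 => p0; apply: e1; apply/gen_gamP => x q x0 xc.
  by rewrite gconstE // => /eqP ->; rewrite p0; apply: le_trans xc cp.
by apply: (e0 c) => //; rewrite ?lex1 // gconstE.
Qed.

Lemma Qpos_half e : Qpos e -> exists2 e', Qpos e' &
  forall c p, c != \bot -> c <= gval e' p ->
    exists2 x, x != \bot & (x <= c) && (x <= gval e (p + p)%R).
Proof.
move=> e0; pose e' : condQ \top := glift2 0%R (fun p _ : rat => p / 2%:R)%R e e.
have H c p : c != \bot -> c <= gval e' p ->
    exists2 x, x != \bot & (x <= c) && (x <= gval e (p + p)%R).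
  move=> c0 /(glift2_force c0)[q [_ [x [x0 xc xq _ <-]]]]; exists x => //.
  by rewrite xc -splitr.
have pos c p : c != \bot -> c <= gval e' p -> (0 < p)%R.
  move=> c0 /(H _ _ c0)[x x0 /andP[xc xe]].
  by have := Qpos_gt0 e0 x0 xe; rewrite -mulr2n pmulrn_lgt0.
exists e' => //; split.
  apply/grel_onP => c p q c0 _; rewrite gconstE // => /eqP -> cq.
  exact/ltW/pos/cq.
move=> a /gen_gamP H0; apply/eqP/negP => /negP a0.
have := H0 a 0%R a0 (lexx _); rewrite gconstE // eqxx => /(_ isT) /(pos _ _ a0).
by rewrite ltxx.
Qed.

Definition Nmax n m : condN \top := glift2 0%N maxn n m.

Lemma Nle_force n m : Nle n m <-> forall c p q, c != \bot ->
  c <= gval n p -> c <= gval m q -> (p <= q)%N.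
Proof.
split=> [/grel_onP H c p q c0|H]; first exact: H (lex1 _).
by apply/grel_onP => c p q c0 _; apply: H.
Qed.

Lemma Nle_refl n : Nle n n.
Proof. by apply/Nle_force => c p q c0 cp cq; rewrite (gval_uniq c0 cp cq). Qed.

Lemma Nle_max n m k : Nle (Nmax n m) k -> Nle n k /\ Nle m k.
Proof.
move=> /Nle_force H; split; apply/Nle_force => c p q c0 cp cq.
  have [j [x [x0 xc xj]]] := gval_force m c0.
  have /(H _ _ q x0) : x <= gval (Nmax n m) (maxn p j).
    by apply: glift2_in => //; apply: le_trans cp.
  by rewrite geq_max => /(_ (le_trans xc cq)) /andP[].
have [j [x [x0 xc xj]]] := gval_force n c0.
have /(H _ _ q x0) : x <= gval (Nmax n m) (maxn j p).
  by apply: glift2_in => //; apply: le_trans cp.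
by rewrite geq_max => /(_ (le_trans xc cq)) /andP[].
Qed.

Lemma Nle_glue (I : Type) (a : I -> A) (nn : I -> condN \top) n0 n :
  cpart \top a -> (forall i, gam (a i) n0 = gam (a i) (nn i)) -> Nle n0 n ->
  forall i, exists2 n', gam (a i) n' = gam (a i) n & Nle (nn i) n'.
Proof.
move=> pa n0E /Nle_force H i; have [n' [n1 n2]] := mix (a i) n (nn i).
exists n' => //; apply/Nle_force => c p q c0 cp cq.
have [ca|ca] := eqVneq (c `&` a i) \bot.
  have cna : c <= ~` a i by rewrite -disj_leC ca eqxx.
  by have cq' := gam_gval n2 c0 cna cq; rewrite (gval_uniq c0 cp cq').
have cca := leIl c (a i); have caa := leIr (a i) c.
apply: (H _ _ _ ca); first exact: gam_gval (esym (n0E i)) ca caa (le_trans cca cp).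
exact: gam_gval n1 ca caa (le_trans cca cq).
Qed.

Lemma tail_glue (I : Type) (a : I -> A) (P : A -> condN \top -> condN \top -> Prop) :
  cpart \top a ->
  (forall b n n' m m', gam b n' = gam b n -> gam b m' = gam b m -> P b n' m' -> P b n m) ->
  (forall i, exists n0, forall n m, Nle n0 n -> Nle n0 m -> P (a i) n m) ->
  exists n0, forall n m, Nle n0 n -> Nle n0 m -> forall i, P (a i) n m.
Proof.
move=> pa Ploc /choice[nn nnP]; have [n0 n0E] := glue_exists nn pa.
exists n0 => n m nn0 mn0 i.
have [n' n1 n2] := Nle_glue pa n0E nn0 i; have [m' m1 m2] := Nle_glue pa n0E mn0 i.
exact: Ploc n1 m1 (nnP i _ _ n2 m2).
Qed.

Lemma tail_glue1 (I : Type) (a : I -> A) (P : A -> condN \top -> Prop) :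
  cpart \top a ->
  (forall b n n', gam b n' = gam b n -> P b n' -> P b n) ->
  (forall i, exists n0, forall n, Nle n0 n -> P (a i) n) ->
  exists n0, forall n, Nle n0 n -> forall i, P (a i) n.
Proof.
move=> pa Ploc H; have [|i|n0 n0P] := @tail_glue I a (fun b n _ => P b n) pa.
- by move=> b n n' _ _ nn _; apply: Ploc.
- by have [n0 n0P] := H i; exists n0 => n _ nn _; apply: n0P.
- by exists n0 => n nn; apply: (n0P n n nn nn).
Qed.

Lemma tail_and (P Q : condN \top -> Prop) :
  (exists n0, forall n, Nle n0 n -> P n) -> (exists n0, forall n, Nle n0 n -> Q n) ->
  exists n0, forall n, Nle n0 n -> P n /\ Q n.
Proof.
move=> [n1 H1] [n2 H2]; exists (Nmax n1 n2) => n /Nle_max[nn1 nn2].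
by split; [apply: H1 | apply: H2].
Qed.

Lemma Qle_gam a f g f' g' : gam a f = gam a f' -> gam a g = gam a g' ->
  Qle_on a f g -> Qle_on a f' g'.
Proof. exact: grel_on_gam. Qed.

Lemma cauchy_eq_sym a s t : cauchy_eq a s t -> cauchy_eq a t s.
Proof.
move=> H e /H[n0 n0P]; exists n0 => n /n0P /grel_onP st.
apply/grel_onP => c p q c0 ca /(glift2_force c0)[i [j [x [x0 xc xi xj <-]]]] cq.
rewrite distrC; apply: (st x) => //; [exact: le_trans xc ca | exact: glift2_in |].
exact: le_trans xc cq.
Qed.

Lemma cauchy_eq_gam a s t : (forall n, gam a (s n) = gam a (t n)) -> cauchy_eq a s t.
Proof.
move=> st e e0; exists (gconst A 0%N 0%N) => n _.
apply/grel_onP => c p q c0 ca /(glift2_force c0)[i [j [x [x0 xc xi xj <-]]]] cq.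
have xs := gam_gval (st n) x0 (le_trans xc ca) xi.
rewrite (gval_uniq x0 xs xj) subrr normr0; apply/ltW.
exact: Qpos_gt0 e0 c0 cq.
Qed.

Lemma cauchy_eq_le a b s t : a <= b -> cauchy_eq b s t -> cauchy_eq a s t.
Proof.
move=> ab H e /H[n0 n0P]; exists n0 => n /n0P; exact: grel_on_le.
Qed.

Lemma cauchy_eq_trans a s t u : cauchy_eq a s t -> cauchy_eq a t u -> cauchy_eq a s u.
Proof.
move=> st tu e /Qpos_half[e' e0 e'P].
have [n0 n0P] := tail_and (st _ e0) (tu _ e0); exists n0 => n /n0P[].
move=> /grel_onP Hs /grel_onP Ht; apply/grel_onP => c p q c0 ca.
move=> /(glift2_force c0)[i [k [x [x0 xc xi xk <-]]]] cq.
have [j [y [y0 yx yj]]] := gval_force (t n) x0.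
have [h [z [z0 zy zh]]] := gval_force e' y0.
have [w w0 /andP[wz we]] := e'P _ _ z0 zh.
have zx := le_trans zy yx; have za := le_trans zx (le_trans xc ca).
have -> : q = (h + h)%R.
  by apply: gval_uniq w0 _ we; apply: le_trans wz (le_trans zx (le_trans xc cq)).
apply: le_trans (ler_distD j _ _) _; apply: lerD.
  apply: (Hs z) => //; apply: glift2_in; first exact: le_trans zx xi.
  exact: le_trans zy yj.
apply: (Ht z) => //; apply: glift2_in; first exact: le_trans zy yj.
exact: le_trans zx xk.
Qed.

Lemma cauchy_eq_glue (I : Type) (a : I -> A) s t : cpart \top a ->
  (forall i, cauchy_eq (a i) s t) -> cauchy_eq \top s t.
Proof.
move=> pa st e e0.
have [||n0 n0P] := @tail_glue1 I a (fun b n => Qle_on b (Qdist (s n) (t n)) e) pa.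
- move=> b n n' nn; apply: Qle_gam => //.
  by apply: glift2_gam; apply: gam_capp.
- by move=> i; have [n0 n0P] := st i _ e0; exists n0.
- by exists n0 => n /n0P; apply: grel_on_glue.
Qed.

Lemma cauchy_glue_exists (I : Type) (a : I -> A) (s : I -> cauchyQ) : cpart \top a ->
  exists t, forall i, cauchy_eq (a i) t (s i).
Proof.
move=> pa; have /choice[f fP] n := glue_exists (fun i => s i n) pa.
have fc b n m : gam b n = gam b m -> gam b (f n) = gam b (f m).
  move=> nm; have pb := cpart_meet b pa; rewrite meetx1 in pb.
  apply: (gam_eq pb) => i.
  have /gam_cons H := leIr (a i) b; rewrite (H _ _ _ (fP n i)) (H _ _ _ (fP m i)).
  by apply: gam_cons (leIl _ _) (gam_capp _ nm).
have tc : is_cauchyQ (condfun_of fc).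
  move=> e e0.
  pose P b n m := Qle_on b (Qdist (condfun_of fc n) (condfun_of fc m)) e.
  have [||n0 n0P] := @tail_glue I a P pa.
  - move=> b n n' m m' nn mm; apply: Qle_gam => //.
    by apply: glift2_gam; apply: gam_capp.
  - move=> i; have [n0 n0P] := cseqP (s i) e0; exists n0 => n m nn mm.
    apply: Qle_gam (grel_on_le (lex1 (a i)) (n0P _ _ nn mm)) => //.
    by apply: glift2_gam; rewrite condfun_ofE fP.
  - by exists n0 => n m nn mm; apply: grel_on_glue pa (n0P n m nn mm).
exists (CauchyQ tc) => i; apply: cauchy_eq_gam => n.
by have -> : CauchyQ tc n = f n := condfun_ofE fc n.
Qed.

Lemma const_compat (x : condQ \top) a (n m : condN \top) :
  gam a n = gam a m -> gam a x = gam a x.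
Proof. by []. Qed.

Lemma const_cauchy (x : condQ \top) : is_cauchyQ (condfun_of (@const_compat x)).
Proof.
move=> e e0; exists (gconst A 0%N 0%N) => n m _ _; rewrite !condfun_ofE.
apply/grel_onP => c p q c0 _ /(glift2_force c0)[i [j [y [y0 _ yi yj <-]]]] cq.
rewrite (gval_uniq y0 yi yj) subrr normr0; exact/ltW/(Qpos_gt0 e0 c0).
Qed.

Definition cauchy_const (x : condQ \top) : cauchyQ := CauchyQ (const_cauchy x).

Lemma add_compat s t a n m :
  gam a n = gam a m -> gam a (Qadd (s n) (t n)) = gam a (Qadd (s m) (t m)).
Proof. by move=> nm; apply: glift2_gam; apply: gam_capp. Qed.

Lemma add_cauchy s t : is_cauchyQ (condfun_of (@add_compat s t)).
Proof.
move=> e /Qpos_half[e' e0 e'P].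
have [ns nsP] := cseqP s e0; have [nt ntP] := cseqP t e0.
exists (Nmax ns nt) => n m /Nle_max[sn tn] /Nle_max[sm tm]; rewrite !condfun_ofE.
have /grel_onP Hs := nsP _ _ sn sm; have /grel_onP Ht := ntP _ _ tn tm.
apply/grel_onP => c r q c0 _.
move=> /(glift2_force c0)[u1 [u2 [x [x0 xc xi xj <-]]]] cq.
have [i1 [j1 [y [y0 yx yi yj <-]]]] := glift2_force x0 xi.
have [i2 [j2 [z [z0 zy zi zj <-]]]] := glift2_force y0 (le_trans yx xj).
have [h [v [v0 vz vh]]] := gval_force e' z0.
have [w w0 /andP[wv we]] := e'P _ _ v0 vh.
have vy := le_trans vz zy; have vx := le_trans vy yx.
have -> : q = (h + h)%R.
  apply: gval_uniq w0 _ we; exact: le_trans wv (le_trans vx (le_trans xc cq)).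
have -> : (i1 + j1 - (i2 + j2) = (i1 - i2) + (j1 - j2))%R by rewrite opprD addrACA.
apply: le_trans (ler_normD _ _) _; apply: lerD.
  apply: (Hs v) => //; rewrite ?lex1 //; apply: glift2_in.
    exact: le_trans vy yi.
  exact: le_trans vz zi.
apply: (Ht v) => //; rewrite ?lex1 //; apply: glift2_in.
  exact: le_trans vy yj.
exact: le_trans vz zj.
Qed.

Definition cauchy_add s t : cauchyQ := CauchyQ (@add_cauchy s t).

Lemma cauchy_eq_refl a s : cauchy_eq a s s.
Proof. exact: cauchy_eq_gam. Qed.

Lemma cauchy_eq_bot s t : cauchy_eq \bot s t.
Proof. by apply: cauchy_eq_gam => n; apply: gam_bot. Qed.

(* R_a is the set of classes of Cauchy sequences modulo equality on a. *)
Definition condR : condSet A := quotC cauchy_eq_refl cauchy_eq_sym cauchy_eq_trans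
  cauchy_eq_le cauchy_eq_bot cauchy_eq_glue cauchy_glue_exists
  (cauchy_const (gconst A 0%R 0%R)).

Definition Rclass s : condR \top := qclass cauchy_eq \top s.

Definition R0 : condR \top := Rclass (cauchy_const (gconst A 0%R 0%R)).
Definition Radd (x y : condR \top) : condR \top := Rclass (cauchy_add (qrepr x) (qrepr y)).
Definition Rle (x y : condR \top) := cauchy_le \top (qrepr x) (qrepr y).
Definition Rlt := cstrict Rle.

Lemma reprRK (x : condR \top) : Rclass (qrepr x) = x.
Proof. exact: (qreprK x). Qed.

Lemma Rclass_gam a s t : gam a (Rclass s) = gam a (Rclass t) <-> cauchy_eq a s t.
Proof.
by rewrite /Rclass !quotC_gamE; apply: qclass_eq; [exact: cauchy_eq_refl |
  exact: cauchy_eq_sym | exact: cauchy_eq_trans].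
Qed.

Lemma Rgam_repr a (x y : condR \top) :
  gam a x = gam a y <-> cauchy_eq a (qrepr x) (qrepr y).
Proof. by rewrite -Rclass_gam !reprRK. Qed.

Lemma repr_Rclass s : cauchy_eq \top (qrepr (Rclass s)) s.
Proof. by apply/Rclass_gam; rewrite reprRK. Qed.

Lemma cauchy_le_glue (I : Type) (a : I -> A) s t : cpart \top a ->
  (forall i, cauchy_le (a i) s t) -> cauchy_le \top s t.
Proof.
move=> pa st e e0.
have [||n0 n0P] := @tail_glue1 I a (fun b n => Qle_on b (s n) (Qadd (t n) e)) pa.
- move=> b n n' nn; apply: Qle_gam; first exact: gam_capp.
  by apply: glift2_gam => //; apply: gam_capp.
- by move=> i; have [n0 n0P] := st i _ e0; exists n0.
- by exists n0 => n /n0P; apply: grel_on_glue.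
Qed.

Lemma cauchy_le_eq a s s' t t' : cauchy_eq a s s' -> cauchy_eq a t t' ->
  cauchy_le a s t -> cauchy_le a s' t'.
Proof.
move=> ss tt st e /Qpos_half[e1 e10 e1P].
have [e2 e20 e2P] := Qpos_half e10.
have [n0 n0P] := tail_and (ss _ e20) (tail_and (tt _ e20) (st _ e10)).
exists n0 => n /n0P[/grel_onP Hs [/grel_onP Ht /grel_onP Hst]].
apply/grel_onP => c p r c0 ca cp /(glift2_force c0)[q [f [x [x0 xc xq xf <-]]]].
have [p' [y1 [y10 y1x y1p]]] := gval_force (s n) x0.
have [q' [y2 [y20 y2y1 y2q]]] := gval_force (t n) y10.
have [h [y3 [y30 y3y2 y3h]]] := gval_force e2 y20.
have [y4 y40 /andP[y43 y4h]] := e2P _ _ y30 y3h.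
have [y5 y50 /andP[y54 y5h]] := e1P _ _ y40 y4h.
have y53 := le_trans y54 y43; have y52 := le_trans y53 y3y2.
have y51 := le_trans y52 y2y1; have y5x := le_trans y51 y1x.
have y5c := le_trans y5x xc; have y5a := le_trans y5c ca.
have -> : f = (h + h + (h + h))%R.
  by apply: gval_uniq y50 _ y5h; apply: le_trans y5x xf.
have Hp : (`|p' - p| <= h)%R.
  apply: (Hs y5) => //; last exact: le_trans y53 y3h.
  by apply: glift2_in; [exact: le_trans y51 y1p | exact: le_trans y5c cp].
have Hq : (`|q' - q| <= h)%R.
  apply: (Ht y5) => //; last exact: le_trans y53 y3h.
  by apply: glift2_in; [exact: le_trans y52 y2q | exact: le_trans y5x xq].
have Hpq : (p' <= q' + (h + h))%R.
  apply: (Hst y5) => //; first exact: le_trans y51 y1p.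
  by apply: glift2_in; [exact: le_trans y52 y2q | exact: le_trans y54 y4h].
have {}Hp : (p <= p' + h)%R.
  by rewrite -lerBlDl; apply: le_trans Hp; rewrite distrC ler_norm.
have {}Hq : (q' <= q + h)%R.
  by rewrite -lerBlDl; apply: le_trans Hq; rewrite ler_norm.
apply: le_trans Hp _; have -> : (q + (h + h + (h + h)) = q + h + (h + h) + h)%R.
  by rewrite !addrA.
by rewrite lerD2r (le_trans Hpq) // lerD2r.
Qed.

Lemma Rle_class s t : Rle (Rclass s) (Rclass t) <-> cauchy_le \top s t.
Proof.
split; apply: cauchy_le_eq; try exact: repr_Rclass;
  apply: cauchy_eq_sym; exact: repr_Rclass.
Qed.

Lemma cauchy_le_mono a b s t : a <= b -> cauchy_le b s t -> cauchy_le a s t.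
Proof. by move=> ab H e /H[n0 n0P]; exists n0 => n /n0P; apply: grel_on_le. Qed.

Lemma Rle_glue (I : Type) (a : I -> A) (x y : condR \top) (xx yy : I -> condR \top) :
  cpart \top a -> (forall i, gam (a i) x = gam (a i) (xx i)) ->
  (forall i, gam (a i) y = gam (a i) (yy i)) ->
  (forall i, Rle (xx i) (yy i)) -> Rle x y.
Proof.
move=> pa xE yE xy; apply: (cauchy_le_glue pa) => i.
apply: cauchy_le_eq (cauchy_le_mono (lex1 (a i)) (xy i)).
  by apply/cauchy_eq_sym/Rgam_repr.
by apply/cauchy_eq_sym/Rgam_repr.
Qed.

Lemma Rle_refl x : Rle x x.
Proof.
move=> e e0; exists (gconst A 0%N 0%N) => n _.
apply/grel_onP => c p r c0 ca cp /(glift2_force c0)[q [f [y [y0 yc yq yf <-]]]].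
rewrite (gval_uniq y0 (le_trans yc cp) yq) lerDl.
exact/ltW/(Qpos_gt0 e0 y0 yf).
Qed.

Lemma Rlt_glue (I : Type) (a : I -> A) (x y : condR \top) (xx : I -> condR \top) :
  cpart \top a -> (forall i, gam (a i) x = gam (a i) (xx i)) ->
  (forall i, Rlt (xx i) y) -> Rlt x y.
Proof.
move=> pa xE xy; split.
  by apply: (@Rle_glue I a _ _ _ (fun=> y)) pa xE _ _ => // i; case: (xy i).
move=> b xyb; apply/eqP/negP => /negP b0.
have [i [c [c0 cb ca]]] := cpart_force pa b0 (lex1 _).
move/negP: c0; apply; apply/eqP; apply: (xy i).2.
by rewrite -(gam_cons ca (xE i)); apply: gam_cons cb xyb.
Qed.

End Numbers.

(* A conditional subset of X living on [cdom]. *)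
Record csub d (A : completeBoolType d) (X : condSet A) := Csub {
  cdom : A;
  cpts : set (X cdom);
  cpts_neq0 : exists x, cpts x;
  cpts_glue : forall (I : Type) (a : I -> A) (y : I -> X cdom) z, cpart cdom a ->
    (forall i, cpts (y i)) -> (forall i, cres (a i) z = cres (a i) (y i)) -> cpts z
}.
Arguments cdom {d A X} Y : rename.
Arguments cpts {d A X} Y x : rename.
Arguments cpts_neq0 {d A X} Y : rename.
Arguments cpts_glue {d A X} Y {I a} y {z} : rename.

Section CondSubsets.
Context d (A : completeBoolType d) (X : condSet A).
Implicit Types (a b c : A) (x z : X \top) (Y Z W : csub X).

Definition csubset Y Z := cdom Y <= cdom Z /\
  forall y, cpts Y y -> exists2 z : X (cdom Z), cpts Z z & cres (cdom Y) z = y.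

(* az is an element of aY *)
Definition inon a z Y := a <= cdom Y /\ exists2 y, cpts Y y & cres a y = gam a z.

(* Conditional membership x \in Y of a conditional element x; it forces
   [cdom Y = \top]. *)
Definition cmem x Y := inon \top x Y.

Lemma inon_le a b z Y : a <= b -> inon b z Y -> inon a z Y.
Proof.
move=> ab [bY [y Yy yz]]; split; first exact: le_trans ab bY.
by exists y => //; apply: gam_cons ab yz.
Qed.

Lemma inon_gam a z z' Y : gam a z = gam a z' -> inon a z Y -> inon a z' Y.
Proof. by move=> zz [aY [y Yy yz]]; split => //; exists y => //; rewrite -zz. Qed.

Lemma inon_glue (I : Type) b (a : I -> A) z Y : cpart b a ->
  (forall i, inon (a i) z Y) -> inon b z Y.
Proof.
move=> pa H; have bY : b <= cdom Y.
  by rewrite -pa.1; apply: csup_le => _ [i _ <-]; case: (H i).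
split=> //.
have /choice[y yP] : forall i, exists y, cpts Y y /\ cres (a i) y = gam (a i) z.
  by move=> i; have [_ [y]] := H i; exists y.
have [y0 Yy0] := cpts_neq0 Y; have pb := cpart_option pa bY.
pose yy i := if i is Some i then y i else y0.
have [w wP] := glue_exists (fun i => clift (yy i)) pb.
exists (gam (cdom Y) w).
  apply: (cpts_glue Y yy pb) => i.
    by case: i => [i|//]; case: (yP i).
  by rewrite cres_gam ?wP // (cpart_le _ pb).
rewrite cres_gam //; apply: (gam_eq pa) => i; rewrite (wP (Some i)) /=.
by have [_] := yP i.
Qed.

Lemma cptsE Y (w : X (cdom Y)) : cpts Y w <-> inon (cdom Y) (clift w) Y.
Proof.
split=> [Yw|[_ [y Yy yw]]]; first by split=> //; exists w.
by move: Yy; rewrite -[w]cliftK -yw -{1}[y]cliftK.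
Qed.

Lemma csubsetP Y Z : csubset Y Z <-> forall a z, inon a z Y -> inon a z Z.
Proof.
split=> [[YZ H] a z [aY [y /H[w Zw wy] yz]]|H].
  split; first exact: le_trans aY YZ.
  by exists w => //; rewrite -yz -wy cres_gam.
have [y0 /cptsE/H[YZ _]] := cpts_neq0 Y; split=> // y /cptsE/H[_ [w Zw wy]].
by exists w => //; rewrite wy cliftK.
Qed.

Lemma csub_eq Y Z : (forall a z, inon a z Y <-> inon a z Z) -> Y = Z.
Proof.
move=> H; have /csubsetP[YZ _] : forall a z, inon a z Y -> inon a z Z.
  by move=> a z /H.
have /csubsetP[ZY _] : forall a z, inon a z Z -> inon a z Y by move=> a z /H.
have E : forall w, cpts Y w <-> inon (cdom Y) (clift w) Y := @cptsE Y.
have E' : forall w, cpts Z w <-> inon (cdom Z) (clift w) Z := @cptsE Z.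
have {YZ ZY} YZ : cdom Y = cdom Z by apply/eqP; rewrite eq_le YZ.
have {}H : forall w : X (cdom Y), inon (cdom Y) (clift w) Y <-> inon (cdom Y) (clift w) Z.
  by move=> w; apply: H.
move: H; case: Y Z YZ E E' => [b Y Y0 Yg] [c Z Z0 Zg] /= bc; case: _ / bc Z Z0 Zg.
move=> Z Z0 Zg E E' H; have YZ : Y = Z.
  by apply/funext => w; apply/propext; rewrite E E' H.
by case: _ / YZ Z0 Zg E' H => *; congr Csub; apply: Prop_irrelevance.
Qed.

Lemma csubset_anti Y Z : csubset Y Z -> csubset Z Y -> Y = Z.
Proof.
by move=> /csubsetP YZ /csubsetP ZY; apply: csub_eq => a z; split; [apply: YZ | apply: ZY].
Qed.

(* The conditional subset of the x that satisfy a local property P,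
   [P a x] being read as "x satisfies P on a"; it lives on the largest a
   on which some x does so. *)
Section Local.
Variable (P : A -> X \top -> Prop).
Hypotheses (Ple : forall a b z, a <= b -> P b z -> P a z)
  (Pgam : forall a z z', gam a z = gam a z' -> P a z -> P a z')
  (Pglue : forall (I : Type) b (a : I -> A) z, cpart b a ->
    (forall i, P (a i) z) -> P b z).

Definition local_dom : A := csup (fun a => exists z, P a z).

Lemma local_neq0 : exists z, P local_dom z.
Proof.
have [I [a [pa aP]]] := refine_sup (fun a => exists z, P a z).
have /choice[z zP] : forall i, exists z, P (a i) z.
  by move=> i; have [b [z bz] ab] := aP i; exists z; apply: Ple ab bz.
have [w wP] := glue_exists z pa.
by exists w; apply: (Pglue pa) => i; apply: Pgam (zP i); rewrite wP.
Qed.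

Definition csub_of : csub X.
Proof.
exists local_dom (fun w => P local_dom (clift w)).
- have [z zP] := local_neq0; exists (gam _ z).
  by apply: Pgam zP; rewrite cliftK.
- move=> I a y z pa yP zy; apply: (Pglue pa) => i.
  by apply: Pgam (Ple (cpart_le i pa) (yP i)); apply/esym/zy.
Defined.

Lemma inon_csub_of a z : inon a z csub_of <-> P a z.
Proof.
split=> [[ad [y Py yz]]|Paz]; first exact: Pgam yz (Ple ad Py).
have ad : a <= local_dom by apply: csup_ub; exists z.
split=> //; have [w Pw] := local_neq0; have [v [va vna]] := mix a z w.
exists (gam local_dom v); last by rewrite cres_gam.
rewrite /=; apply: (@Pgam _ v); first by rewrite cliftK.
have := cpart_meet local_dom (cpart_bool a); rewrite meetx1 => pd.
apply: (Pglue pd) => -[]; last first.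
  apply: Pgam (Ple (leIl _ _) Pw); apply/esym/(gam_cons (leIr _ _) vna).
by apply: Ple (leIr _ _) _; apply: Pgam Paz; apply/esym.
Qed.
End Local.

(* aY *)
Definition crestr a Y : csub X.
Proof.
exists (a `&` cdom Y)
  (fun w => exists2 y, cpts Y y & cres (a `&` cdom Y) y = w).
- by have [y Yy] := cpts_neq0 Y; exists (cres (a `&` cdom Y) y); exists y.
- move=> I b y z pb yP zE.
  have H i : inon (b i) (clift z) Y.
    apply: (inon_gam (z := clift (y i))); first exact/esym/zE.
    split; first exact: le_trans (cpart_le i pb) (leIr _ _).
    have [w Yw wy] := yP i; exists w => //; rewrite -wy.
    by rewrite -/(cres (b i) (gam _ (clift w))) cres_gam // (cpart_le _ pb).
  have [_ [w Yw wz]] := inon_glue pb H.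
  by exists w => //; rewrite wz cliftK.
Defined.

Lemma inon_crestr b a z Y : inon b z (crestr a Y) <-> b <= a /\ inon b z Y.
Proof.
split=> [[/= bd [_ [y Yy <-] yz]]|[ba [bY [y Yy yz]]]].
  split; first exact: le_trans bd (leIl _ _).
  split; first exact: le_trans bd (leIr _ _).
  by exists y => //; rewrite -yz [RHS]cres_gam.
have bd : b <= a `&` cdom Y by rewrite lexI ba.
split=> //; exists (cres (a `&` cdom Y) y); first by exists y.
by rewrite [LHS]cres_gam.
Qed.

Definition cfull : csub X.
Proof.
exists \top (fun=> True) => //; have [e _] := carr_bot X; exists (clift e) => //.
Defined.

Definition czero : csub X.
Proof.
exists \bot (fun=> True) => //; have [e _] := carr_bot X; exists e => //.
Defined.

Lemma inon_cfull a z : inon a z cfull.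
Proof. by split; [exact: lex1 | exists z => //; rewrite /cres clift_top]. Qed.

Lemma inon_bot z Y : inon \bot z Y.
Proof.
split; first exact: le0x.
by have [y Yy] := cpts_neq0 Y; exists y => //; apply: gam_bot.
Qed.

(* z lies in the conditional union on c if c is covered by the b such that z
   lies on b in one of the F k *)
Definition cjoin_on (K : Type) (F : K -> csub X) c z :=
  c <= csup (fun b => exists k, inon b z (F k)).

Lemma cjoin_on_le (K : Type) (F : K -> csub X) a b z :
  a <= b -> cjoin_on F b z -> cjoin_on F a z.
Proof. exact: le_trans. Qed.

Lemma cjoin_on_gam (K : Type) (F : K -> csub X) a z z' :
  gam a z = gam a z' -> cjoin_on F a z -> cjoin_on F a z'.
Proof.
move=> zz az; apply: force_le => c c0 ca.
have [b [e [[k bk] e0 ec eb]]] := csup_force c0 (le_trans ca az).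
exists e => //; rewrite ec; apply: csup_ub; exists k.
by apply: inon_gam (inon_le eb bk); apply: gam_cons zz; apply: le_trans ec ca.
Qed.

Lemma cjoin_on_glue (K : Type) (F : K -> csub X) (I : Type) b (a : I -> A) z :
  cpart b a -> (forall i, cjoin_on F (a i) z) -> cjoin_on F b z.
Proof. by move=> [<- _] H; apply: csup_le => _ [i _ <-]; apply: H. Qed.

Definition cjoin (K : Type) (F : K -> csub X) : csub X :=
  csub_of (@cjoin_on_le K F) (@cjoin_on_gam K F) (@cjoin_on_glue K F).

Definition cmeet_on Y Z c z := inon c z Y /\ inon c z Z.

Lemma cmeet_on_le Y Z a b z : a <= b -> cmeet_on Y Z b z -> cmeet_on Y Z a z.
Proof. by move=> ab [bY bZ]; split; apply: inon_le ab _. Qed.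

Lemma cmeet_on_gam Y Z a z z' :
  gam a z = gam a z' -> cmeet_on Y Z a z -> cmeet_on Y Z a z'.
Proof. by move=> zz [aY aZ]; split; apply: inon_gam zz _. Qed.

Lemma cmeet_on_glue Y Z (I : Type) b (a : I -> A) z :
  cpart b a -> (forall i, cmeet_on Y Z (a i) z) -> cmeet_on Y Z b z.
Proof. by move=> pa H; split; apply: (inon_glue pa) => i; case: (H i). Qed.

Definition cmeet Y Z : csub X :=
  csub_of (@cmeet_on_le Y Z) (@cmeet_on_gam Y Z) (@cmeet_on_glue Y Z).

Lemma inon_cjoin (K : Type) (F : K -> csub X) c z : inon c z (cjoin F) <-> cjoin_on F c z.
Proof. exact: inon_csub_of. Qed.

Lemma inon_cmeet Y Z c z : inon c z (cmeet Y Z) <-> inon c z Y /\ inon c z Z.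
Proof. exact: inon_csub_of. Qed.

Lemma cjoin_ub (K : Type) (F : K -> csub X) k : csubset (F k) (cjoin F).
Proof. by apply/csubsetP => a z az; apply/inon_cjoin/csup_ub; exists k. Qed.

Lemma cjoin_least (K : Type) (F : K -> csub X) Y :
  (forall k, csubset (F k) Y) -> csubset (cjoin F) Y.
Proof.
move=> H; apply/csubsetP => a z /inon_cjoin az.
have [I [b [pb bP]]] := refine_sup (fun b => exists k, inon b z (F k)).
apply: inon_le az _; apply: (inon_glue pb) => i.
by have [c [k ck] bc] := bP i; have /csubsetP := H k; apply; apply: inon_le bc ck.
Qed.

Lemma cmeetP W Y Z : csubset W (cmeet Y Z) <-> csubset W Y /\ csubset W Z.
Proof.
split=> [/csubsetP H|[/csubsetP HY /csubsetP HZ]].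
  by split; apply/csubsetP => a z /H /inon_cmeet[].
by apply/csubsetP => a z az; apply/inon_cmeet; split; [apply: HY | apply: HZ].
Qed.

End CondSubsets.

(* The conditional power set: P(X)_a consists of the conditional subsets of X
   living on some b <= a. *)
Section PowerSet.
Context d (A : completeBoolType d) (X : condSet A).
Implicit Types (a b c : A).

Definition powC_gam a (Y : {Y : csub X | cdom Y <= \top}) : {Y : csub X | cdom Y <= a} :=
  exist _ (crestr a (sval Y)) (leIl _ _).

Lemma powC_gam_eq a Y Z : powC_gam a Y = powC_gam a Z <->
  forall b z, b <= a -> inon b z (sval Y) <-> inon b z (sval Z).
Proof.
split=> [/(congr1 sval)/= YZ b z ba|H].
  split=> h.
    by have /inon_crestr[] : inon b z (crestr a (sval Z)) by rewrite -YZ; apply/inon_crestr.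
  by have /inon_crestr[] : inon b z (crestr a (sval Y)) by rewrite YZ; apply/inon_crestr.
apply: eq_exist; apply: csub_eq => b z; split=> /inon_crestr[ba bz];
  by apply/inon_crestr; split=> //; apply/H.
Qed.

Definition powC : condSet A.
Proof.
exists (fun a => {Y : csub X | cdom Y <= a}) powC_gam.
- move=> a [Y Ya]; exists (exist _ Y (lex1 _)); apply: eq_exist.
  apply: csub_eq => b z; split=> [/inon_crestr[]//|bY].
  by apply/inon_crestr; split=> //; apply: le_trans bY.1 Ya.
- move=> [Y Ya]; apply: eq_exist; apply: csub_eq => b z.
  split=> [/inon_crestr[]//|bY]; apply/inon_crestr; split=> //; exact: lex1.
- exists (exist _ (czero X) (lexx \bot)) => -[Y Y0]; apply: eq_exist.
  apply: csub_eq => b z; have H (W : csub X) : cdom W <= \bot ->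
      inon b z W <-> b <= \bot.
    move=> W0; split=> [[bW _]|b0]; first exact: le_trans bW W0.
    exact: inon_le b0 (inon_bot _ _).
  by rewrite !H.
- move=> a b Y Z ab /powC_gam_eq YZ; apply/powC_gam_eq => c z ca.
  by apply: YZ; apply: le_trans ca ab.
- move=> I a Y pa.
  pose P c z := forall i, inon (c `&` a i) z (sval (Y i)).
  have Ple b c z : b <= c -> P c z -> P b z.
    by move=> bc H i; apply: inon_le (H i); rewrite leI2.
  have Pgam b z z' : gam b z = gam b z' -> P b z -> P b z'.
    by move=> zz H i; apply: inon_gam (H i); apply: gam_cons zz; apply: leIl.
  have Pglue (J : Type) b (c : J -> A) z : cpart b c -> (forall j, P (c j) z) -> P b z.
    move=> pc H i; have := cpart_meet (a i) pc; rewrite [_ `&` b]meetC => pd.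
    by apply: (inon_glue pd) => j; rewrite meetC; apply: H.
  have WP := inon_csub_of Ple Pgam Pglue.
  exists (exist _ (csub_of Ple Pgam Pglue) (lex1 _)); split=> [i|[W W1] HW].
    apply/powC_gam_eq => b z ba; rewrite WP; split=> [/(_ i)|bY j].
      by have /meet_idPl -> := ba.
    have [<-|ij] := pselect (i = j); first exact: inon_le (leIl _ _) bY.
    suff -> : b `&` a j = \bot by apply: inon_bot.
    by apply/eqP; rewrite -lex0 -(pa.2 _ _ ij) leI2.
  apply: eq_exist; apply: csub_eq => b z; rewrite WP.
  have H i : inon (b `&` a i) z W <-> inon (b `&` a i) z (sval (Y i)).
    by have /powC_gam_eq -> := HW i; rewrite ?leIr.
  split=> [bP|bW i]; last by apply/H; apply: inon_le (leIl _ _) bW.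
  have := cpart_meet b pa; rewrite meetx1 => pb.
  by apply: (inon_glue pb) => i; apply/H.
Defined.

End PowerSet.

Definition Rplus_set d (A : completeBoolType d) : set (condR A \top) :=
  [set x | Rle (R0 A) x].

Lemma Rplus_neq0 d (A : completeBoolType d) : exists x, Rplus_set (A := A) x.
Proof. by exists (R0 A); apply: Rle_refl. Qed.

Lemma Rplus_stable d (A : completeBoolType d) : stable (Rplus_set (A := A)).
Proof.
move=> I a y z pa yP zy.
by apply: (@Rle_glue _ A I a _ _ (fun=> R0 A) y) => //.
Qed.

Definition condRplus d (A : completeBoolType d) : condSet A :=
  subC (Rplus_neq0 A) (@Rplus_stable d A).

Definition Rpos d (A : completeBoolType d) (e : condR A \top) := Rlt (R0 A) e.

Definition dist_of d (A : completeBoolType d) (X : condSet A)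
    (D : condFun (prodC X X) (condRplus A)) (x y : X \top) : condR A \top :=
  sval (D (x, y)).

Record condMetric d (A : completeBoolType d) (X : condSet A) := CondMetric {
  cmetric :> condFun (prodC X X) (condRplus A);
  cdist0 : forall x y, dist_of cmetric x y = R0 A <-> x = y;
  cdistC : forall x y, dist_of cmetric x y = dist_of cmetric y x;
  cdist_triangle : forall x y z,
    Rle (dist_of cmetric x z) (Radd (dist_of cmetric x y) (dist_of cmetric y z))
}.

Section MetricSpace.
Context d (A : completeBoolType d) (X : condSet A) (D : condMetric X).
Implicit Types (x y z l : X \top) (e : condR A \top) (U V : csub X)
  (s : condFun (condN A) X) (n m : condN A \top).

Definition cdist x y := dist_of D x y.

Lemma cdist_gam a x x' y y' : gam a x = gam a x' -> gam a y = gam a y' ->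
  gam a (cdist x y) = gam a (cdist x' y').
Proof.
move=> xx yy; have xyE : gam (X := prodC X X) a (x, y) = gam a ((x', y') : prodC X X \top).
  by congr pair.
exact: (congr1 sval (gam_capp D xyE)).
Qed.

Definition cball x e (e0 : Rpos e) : csub X.
Proof.
exists \top [set y | Rlt (cdist x y) e].
- by exists x; rewrite /cdist /= (cdist0 D x x).2.
- move=> I a y z pa yP zy; apply: (Rlt_glue pa) yP => i.
  by apply: cdist_gam => //; have := zy i; rewrite /cres !clift_top.
Defined.

Definition is_ctopology (T : set (csub X)) := [/\ T (czero X), T (cfull X),
  (forall (I : Type) (a : I -> A) (O : I -> csub X) U, cpart \top a ->
     (forall i, T (O i)) -> (forall i, crestr (a i) U = crestr (a i) (O i)) -> T U),
  (forall U V, T U -> T V -> T (cmeet U V)) &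
  (forall (K : Type) (O : K -> csub X), (forall k, T (O k)) -> T (cjoin O))].

(* The topology generated by the balls is the smallest one containing them. *)
Definition copen U := forall T : set (csub X), is_ctopology T ->
  (forall x e (e0 : Rpos e), T (cball x e0)) -> T U.

Definition cnbhd x U := exists O, [/\ copen O, cmem x O & csubset O U].

Definition cconverges s l :=
  forall U, cnbhd l U -> exists n0, forall n, Nle n0 n -> cmem (s n) U.

Definition ccauchy s := forall e, Rpos e ->
  exists n0, forall n m, Nle n0 n -> Nle n0 m -> Rle (cdist (s n) (s m)) e.

Definition ccluster s l :=
  forall U, cnbhd l U -> forall n, exists m, Nle n m /\ cmem (s m) U.

Definition ccomplete := forall s, ccauchy s -> exists l, cconverges s l.

Definition cseq_compact := forall s, exists l, ccluster s l.

End MetricSpace.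

Section Segment.
Context d (A : completeBoolType d) (n : condN A \top).

Definition segment_set : set (condN A \top) :=
  [set k | Nle (gconst A 0%N 1%N) k /\ Nle k n].

Lemma segment_stable : stable segment_set.
Proof.
move=> I a y z pa yP zy; split; apply: (grel_on_glue pa) => i;
  [have [H _] := yP i | have [_ H] := yP i];
  by apply: grel_on_gam (grel_on_le (lex1 (a i)) H).
Qed.

Hypothesis n_ge1 : Nle (gconst A 0%N 1%N) n.

Lemma segment_neq0 : exists k, segment_set k.
Proof. by exists n; split => //; apply: Nle_refl. Qed.

(* the conditional set {k in N : 1 <= k <= n} *)
Definition segment : condSet A := subC segment_neq0 segment_stable.
End Segment.

(* [segment n1] is a conditional set living on 1 only if n >= 1; without this
   the balls could not cover X. *)
Definition ctotally_bounded d (A : completeBoolType d) (X : condSet A)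
    (D : condMetric X) :=
  forall e (e0 : Rpos e), exists n (n1 : Nle (gconst A 0%N 1%N) n)
    (x : condFun (segment n1) X),
    csubset (cfull X) (cjoin (fun k : segment n1 \top => cball D (x k) e0)).

(* A conditional family (O^j) is a conditional function from J to P(X). *)
Definition ccompact d (A : completeBoolType d) (X : condSet A) (D : condMetric X) :=
  forall (J : condSet A) (O : condFun J (powC X)),
    (forall j, copen D (sval (O j))) ->
    csubset (cfull X) (cjoin (fun j : J \top => sval (O j))) ->
    exists (I : Type) (a : I -> A) (F : I -> set (J \top)), cpart \top a /\
      forall i, finite_set (F i) /\
        csubset (crestr (a i) (cfull X))
          (cjoin (fun j : {j | F i j} =>
             cmeet (sval (O (sval j))) (crestr (a i) (cfull X)))).

(* Main.v *)
(* The equivalence is proved along (i) => (iii) => (ii) => (i), each step being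
   the classical argument carried out locally: a statement is forced on an
   element of the Boolean algebra as soon as it holds on a dense set of nonzero
   elements below it, and the local witnesses are glued along a partition.
   Since a positive conditional real dominates a positive rational on a dense
   set of elements, only the relations "d(x,y) <= q on a" with q rational are
   needed, and a conditional set U is open iff each of its points has, densely,
   a ball of rational radius inside U.  Conditional sequences and conditionally
   finite families are locally ordinary ones.
   (i) => (iii): if no cluster point existed on any nonzero element below c,
   the complements of the closures of the tails would form an open cover
   without finite subcover.
   (iii) => (ii): a Cauchy sequence converges to its cluster points, and
   without finite q-nets below c there is a sequence that is q-separated on
   every nonzero element below c.
   (ii) => (i): if no nonzero element below c had a finite subcover, nested
   choices of balls of radii 2^-k, none of which has a finite subcover on a
   nonzero element below c, would converge to a point that no O^j contains. *)
Require Import Defs.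
From mathcomp Require Import all_boot all_order all_algebra.
From mathcomp Require Import boolp classical_sets cardinality.
From mathcomp Require Import lra.

Set Implicit Arguments.
Unset Strict Implicit.
Unset Printing Implicit Defensive.

Import Order.Theory GRing.Theory Num.Theory.

Local Open Scope classical_set_scope.
Local Open Scope order_scope.

(** * Density and conditional reals *)

(** Backtracking search for a path of hypotheses from the left side to the right; repeated shrinking
    of elements leaves such paths in the context. *)
Ltac chain :=
  match goal with
  | |- is_true (?x <= ?x) => exact: lexx
  | |- is_true (_ <= \top) => exact: lex1
  | H : is_true (?x <= ?y) |- is_true (?x <= ?y) => exact: H
  | H : is_true (?x <= ?y) |- is_true (?x <= _) => apply: (le_trans H); chain
  end.

Section Density.
Context d (A : completeBoolType d).
Implicit Types (a b c e : A).

(** By density the elements [e <= b] with [P e] have join [b]; refining this join to a partition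
    keeps [P] by downward closure. Forcing arguments become gluings through this. *)
Lemma dense_part (P : A -> Prop) b :
  (forall a c, a <= c -> P c -> P a) ->
  (forall c, c != \bot -> c <= b -> exists e, [/\ e != \bot, e <= c & P e]) ->
  exists (I : Type) (a : I -> A), cpart b a /\ forall i, P (a i).
Proof.
move=> Ple Pd; have [I [a [pa aP]]] := refine_sup [set e | e <= b /\ P e].
exists I, a; split; last by move=> i; have [e [_ Pe] ae] := aP i; apply: Ple ae Pe.
suff <- : csup [set e | e <= b /\ P e] = b by [].
apply/eqP; rewrite eq_le; apply/andP; split; first by apply: csup_le => e [].
apply: force_le => c c0 cb; have [e [e0 ec Pe]] := Pd _ c0 cb.
by exists e => //; rewrite ec; apply: csup_ub; split=> //; chain.
Qed.

(** Mixing principle: witnesses chosen on the pieces of a partition glue to a single one, and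
    locality of [P] transfers the property to it. *)
Lemma dense_exists (X : condSet A) (P : A -> X \top -> Prop) b :
  (forall a c z, a <= c -> P c z -> P a z) ->
  (forall a z z', gam a z = gam a z' -> P a z -> P a z') ->
  (forall (I : Type) c (a : I -> A) z, cpart c a -> (forall i, P (a i) z) -> P c z) ->
  (forall c, c != \bot -> c <= b -> exists e z, [/\ e != \bot, e <= c & P e z]) ->
  exists z, P b z.
Proof.
move=> Ple Pgam Pglue Pd.
have [||I [a [pa /choice[z zP]]]] := @dense_part (fun e => exists z, P e z) b.
- by move=> a c ac [z /(Ple _ _ _ ac)]; exists z.
- by move=> c c0 cb; have [e [z [e0 ec Pe]]] := Pd _ c0 cb; exists e; split=> //; exists z.
have [w wP] := glue_exists z pa.
by exists w; apply: (Pglue _ _ _ _ pa) => i; apply: Pgam (zP i); rewrite wP.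
Qed.

Lemma gconst_le (E : eqType) (e0 e : E) c : c <= gval (@gconst d A E e0 e) e.
Proof. by rewrite /gval /= eqxx lex1. Qed.

Lemma gconst_val (E : eqType) (e0 e p : E) c : c != \bot ->
  c <= gval (@gconst d A E e0 e) p -> p = e.
Proof. by move=> c0; rewrite gconstE // => /eqP. Qed.

End Density.

Section Reals.
Context d (A : completeBoolType d).
Implicit Types (a b c : A) (s t u : cauchyQ A) (n m : condN A \top) (p q e : rat).
Local Open Scope ring_scope.

Lemma gconst_pos e : 0 < e -> Qpos (gconst A 0 e).
Proof.
move=> e0; split.
  by apply/grel_onP => c p q c0 _ /(gconst_val c0) -> /(gconst_val c0) ->; apply: ltW.
move=> a /gen_gamP H; apply/eqP/negP => /negP a0.
have /(gconst_val a0) E := H a 0 a0 (lexx a) (gconst_le _ _ _).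
by rewrite -E ltxx in e0.
Qed.

(** The pieces on which [e] has an ordinary value [h] form a partition, so thresholds for rational
    tolerances glue to a threshold for [e]. *)
Lemma tail_rat a (f g : condFun (condN A) (condQ A)) (r : rat -> rat -> rat -> Prop) :
  (forall e, 0 < e -> exists n0, forall n, Nle n0 n -> grel_on (r e) a (f n) (g n)) ->
  forall e : condQ A \top, Qpos e -> exists n0, forall n, Nle n0 n ->
    forall c p q h, c != \bot%O -> (c <= a)%O -> (c <= gval (f n) p)%O ->
    (c <= gval (g n) q)%O -> (c <= gval e h)%O -> r h p q.
Proof.
move=> H e e0; pose P b n := forall c p q h, c != \bot%O -> (c <= a)%O -> (c <= b)%O ->
  (c <= gval (f n) p)%O -> (c <= gval (g n) q)%O -> (c <= gval e h)%O -> r h p q.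
have [||n0 n0P] := @tail_glue1 _ A rat (gval e) P (gval_part e).
- move=> b n n' nn HP c p q h c0 ca cb cp cq ch.
  apply: (HP c) => //; first exact: (gam_gval (esym (gam_capp f nn)) c0 cb cp).
  exact: (gam_gval (esym (gam_capp g nn)) c0 cb cq).
(* Positivity of [e] leaves no nonzero element on a piece with [h <= 0], so any threshold works
   there. *)
- move=> h; have [h0|h0] := ltP 0 h; last first.
    exists (gconst A 0%N 0%N) => n _ c p q h' c0 _ /(Qpos_gt0 e0 c0).
    by rewrite ltNge h0.
  have [n0 n0P] := H _ h0; exists n0 => n /n0P/grel_onP nP c p q h' c0 ca ch cp cq ch'.
  by rewrite (gval_uniq c0 ch' ch); apply: nP cp cq.
exists n0 => n nn c p q h c0 ca cp cq ch.
by apply: (n0P n nn h c) => //; rewrite lexx.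
Qed.

Lemma cauchy_leP a s t : cauchy_le a s t <-> forall e, 0 < e ->
  exists n0, forall n, Nle n0 n -> grel_on (fun p q => p <= q + e) a (s n) (t n).
Proof.
split=> [H e e0|/tail_rat H e /H[n0 n0P]].
  have [n0 n0P] := H _ (gconst_pos e0); exists n0 => n /n0P/grel_onP nP.
  apply/grel_onP => c p q c0 ca cp cq; apply: (nP c) => //.
  exact: glift2_in cq (gconst_le _ _ _).
exists n0 => n /n0P nP; apply/grel_onP => c p r c0 ca cp.
move=> /(glift2_force c0)[q [h [x [x0 xc xq xh <-]]]].
by apply: (nP x) => //; chain.
Qed.

Lemma cauchy_eqP a s t : cauchy_eq a s t <-> forall e, 0 < e ->
  exists n0, forall n, Nle n0 n -> grel_on (fun p q => `|p - q| <= e) a (s n) (t n).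
Proof.
split=> [H e e0|/tail_rat H e /H[n0 n0P]].
  have [n0 n0P] := H _ (gconst_pos e0); exists n0 => n /n0P/grel_onP nP.
  apply/grel_onP => c p q c0 ca cp cq; apply: (nP c) => //; last exact: gconst_le.
  exact: glift2_in cp cq.
exists n0 => n /n0P nP; apply/grel_onP => c r h c0 ca.
move=> /(glift2_force c0)[p [q [x [x0 xc xp xq <-]]]] ch.
by apply: (nP x) => //; chain.
Qed.

Lemma cauchyQ_rat s e : 0 < e -> exists n0, forall n m, Nle n0 n -> Nle n0 m ->
  grel_on (fun p q => `|p - q| <= e) \top%O (s n) (s m).
Proof.
move=> e0; have [n0 n0P] := cseqP s (gconst_pos e0); exists n0 => n m nn mm.
have /grel_onP H := n0P _ _ nn mm; apply/grel_onP => c p q c0 ca cp cq.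
by apply: (H c) => //; [apply: glift2_in | apply: gconst_le].
Qed.

Definition cconst q : cauchyQ A := cauchy_const (gconst A 0 q).

Lemma cconstE q n : cconst q n = gconst A 0 q.
Proof. exact: condfun_ofE. Qed.

Lemma cauchy_addE s t n : cauchy_add s t n = Qadd (s n) (t n).
Proof. exact: condfun_ofE. Qed.

Lemma cauchy_le_trans a s t u : cauchy_le a s t -> cauchy_le a t u -> cauchy_le a s u.
Proof.
move=> /cauchy_leP st /cauchy_leP tu; apply/cauchy_leP => e e0.
have e2 : 0 < e / 2 by lra.
have [n0 n0P] := tail_and (st _ e2) (tu _ e2); exists n0 => n /n0P[/grel_onP H1 /grel_onP H2].
apply/grel_onP => c p r c0 ca cp cr; have [q [x [x0 xc xq]]] := gval_force (t n) c0.
have := H1 x p q x0 ltac:(chain) ltac:(chain) xq.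
have := H2 x q r x0 ltac:(chain) xq ltac:(chain); lra.
Qed.

Lemma cauchy_le_add a s s' t t' : cauchy_le a s s' -> cauchy_le a t t' ->
  cauchy_le a (cauchy_add s t) (cauchy_add s' t').
Proof.
move=> /cauchy_leP ss /cauchy_leP tt; apply/cauchy_leP => e e0.
have e2 : 0 < e / 2 by lra.
have [n0 n0P] := tail_and (ss _ e2) (tt _ e2); exists n0 => n /n0P[/grel_onP H1 /grel_onP H2].
apply/grel_onP => c p r c0 ca; rewrite !cauchy_addE.
move=> /(glift2_force c0)[p1 [p2 [x [x0 xc xp1 xp2 <-]]]] cr.
have /(glift2_force x0)[q1 [q2 [y [y0 yx yq1 yq2 <-]]]] : (x <= gval (Qadd (s' n) (t' n)) r)%O.
  by chain.
have := H1 y p1 q1 y0 ltac:(chain) ltac:(chain) yq1.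
have := H2 y p2 q2 y0 ltac:(chain) ltac:(chain) yq2; lra.
Qed.

Lemma cconst_le a p q : p <= q -> cauchy_le a (cconst p) (cconst q).
Proof.
move=> pq; apply/cauchy_leP => e e0; exists (gconst A 0%N 0%N) => n _.
rewrite !cconstE; apply/grel_onP => c i j c0 _ /(gconst_val c0) -> /(gconst_val c0) ->; lra.
Qed.

Lemma cconst_le_inv a p q : a != \bot%O -> cauchy_le a (cconst p) (cconst q) -> p <= q.
Proof.
move=> a0 /cauchy_leP H; apply/ler_addgt0Pr => e e0; have [n0 n0P] := H _ e0.
have /grel_onP := n0P n0 (@Nle_refl _ _ n0); rewrite !cconstE.
by apply; [exact: a0 | exact: lexx | exact: gconst_le | exact: gconst_le].
Qed.

Lemma cconst_add a p q : cauchy_le a (cauchy_add (cconst p) (cconst q)) (cconst (p + q)).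
Proof.
apply/cauchy_leP => e e0; exists (gconst A 0%N 0%N) => n _.
rewrite cauchy_addE !cconstE; apply/grel_onP => c i j c0 _.
move=> /(glift2_force c0)[p1 [p2 [x [x0 xc]]]] /(gconst_val x0) -> /(gconst_val x0) -> <-.
move=> /(gconst_val c0) ->; lra.
Qed.

Lemma cauchy_eq_leW a s t : cauchy_eq a s t -> cauchy_le a s t.
Proof.
move=> /cauchy_eqP st; apply/cauchy_leP => e /st[n0 n0P]; exists n0 => n /n0P.
move=> /grel_onP H; apply/grel_onP => c p q c0 ca cp cq.
have := H c p q c0 ca cp cq; rewrite ler_norml => /andP[_]; lra.
Qed.

(** Thresholds glue along partitions of [\top], so the complement of [b] is added as one more piece;
    cutting the condition down to [b] makes it vacuous there. *)
Lemma cauchy_le_part (I : Type) b (a : I -> A) s t : cpart b a ->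
  (forall i, cauchy_le (a i) s t) -> cauchy_le b s t.
Proof.
move=> pa H; apply/cauchy_leP => e e0.
pose P c n := grel_on (fun p q => p <= q + e) (c `&` b)%O (s n) (t n).
have [||n0 n0P] := @tail_glue1 _ A _ _ P (cpart_option pa (lex1 b)).
- by move=> c n n' nn; apply: grel_on_gam; apply: gam_cons (leIl _ _) _; apply: gam_capp.
- move=> [i|].
    have /cauchy_leP/(_ e e0)[n0 n0P] := H i; exists n0 => n /n0P.
    by apply: grel_on_le; apply: leIl.
  exists (gconst A 0%N 0%N) => n _; apply/grel_onP => c p q c0.
  by rewrite meet1x meetC meetxC lex0 (negbTE c0).
exists n0 => n /n0P nP; apply: (grel_on_glue pa) => i.
by apply: grel_on_le (nP (Some i)); rewrite lexI lexx (cpart_le _ pa).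
Qed.

(** For [p < q] this is a rational gap between [s] and [t]. Such gaps on a dense set of elements
    characterize [Rlt], by the lemmas [Rlt_between] and [between_Rlt]. *)
Definition rat_between c s t p q := cauchy_le c s (cconst p) /\ cauchy_le c (cconst q) t.

Lemma Rlt_between (x y : condR A \top) c : Rlt x y -> c != \bot%O ->
  exists (e : A) p q,
    [/\ e != \bot%O, (e <= c)%O, p < q & rat_between e (qrepr x) (qrepr y) p q].
Proof.
move=> [xy0 xyN] c0; set s := qrepr x; set t := qrepr y.
have /cauchy_leP xy : cauchy_le \top s t := xy0.
have /existsNP[h /not_implyP[h0 Hh]] : ~ forall e, 0 < e -> exists n0, forall n,
    Nle n0 n -> grel_on (fun p q => `|p - q| <= e) c (s n) (t n).
  by move=> /cauchy_eqP/Rgam_repr/xyN c0'; rewrite c0' eqxx in c0.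
(* Both ends of the gap [v - u > h] will move inwards by [h / 4], which leaves more than [h / 2]. *)
have h4 : 0 < h / 4 by lra.
have [n1 n1P] := cauchyQ_rat s h4; have [n2 n2P] := cauchyQ_rat t h4.
have [n3 n3P] := xy _ h4.
have /existsNP[n /not_implyP[nn]] : ~ forall n, Nle (Nmax n1 (Nmax n2 n3)) n ->
    grel_on (fun p q => `|p - q| <= h) c (s n) (t n).
  by move=> H; apply: Hh; exists (Nmax n1 (Nmax n2 n3)).
have [nn1 /Nle_max[nn2 nn3]] := Nle_max nn.
move=> /grel_onP/existsNP[e /existsNP[u /existsNP[v]]].
move=> /not_implyP[e0 /not_implyP[ec /not_implyP[eu /not_implyP[ev uv]]]].
have uv' : u <= v + h / 4 by have /grel_onP := n3P _ nn3; apply; [exact: e0 | exact: lex1 | |].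
(* [uv'] excludes that the large difference has the wrong sign. *)
have {}uv : h < v - u.
  move: uv => /negP; rewrite -ltNge; have [vu|vu] := leP 0 (u - v).
    by rewrite ger0_norm //; lra.
  by rewrite ltr0_norm //; lra.
exists e, (u + h / 4), (v - h / 4); split=> //; first lra.
split; apply/cauchy_leP => k k0.
  exists n1 => m mm; have /grel_onP H := n1P _ _ nn1 mm; rewrite cconstE.
  apply/grel_onP => f p q f0 fe fp /(gconst_val f0) ->.
  have := H f u p f0 (lex1 _) ltac:(chain) fp; rewrite ler_norml => /andP[]; lra.
exists n2 => m mm; have /grel_onP H := n2P _ _ nn2 mm; rewrite cconstE.
apply/grel_onP => f p q f0 fe /(gconst_val f0) -> fq.
have := H f v q f0 (lex1 _) ltac:(chain) fq; rewrite ler_norml => /andP[]; lra.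
Qed.

(** The gaps give [<=] piecewise; equality on a nonzero element would close a gap and force
    [q <= p]. *)
Lemma between_Rlt (x y : condR A \top) :
  (forall c, c != \bot%O -> exists (e : A) p q,
     [/\ e != \bot%O, (e <= c)%O, p < q & rat_between e (qrepr x) (qrepr y) p q]) ->
  Rlt x y.
Proof.
move=> H; split.
  pose P c := cauchy_le c (qrepr x) (qrepr y).
  have [||I [a [pa aP]]] := @dense_part _ A P \top%O.
  - by move=> a c; apply: cauchy_le_mono.
  - move=> c c0 _; have [e [p [q [e0 ec pq [xp qy]]]]] := H _ c0; exists e; split=> //.
    apply: cauchy_le_trans xp (cauchy_le_trans _ qy); exact/cconst_le/ltW.
  exact: cauchy_le_part pa aP.
move=> a /Rgam_repr xy; apply/eqP/negP => /negP /H[e [p [q [e0 ea pq [xp qy]]]]].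
have /cauchy_eq_sym/cauchy_eq_leW yx := cauchy_eq_le ea xy.
have /(cconst_le_inv e0) := cauchy_le_trans qy (cauchy_le_trans yx xp).
by rewrite leNgt pq.
Qed.

Definition Rrat q : condR A \top := Rclass (cconst q).

Lemma Rrat_repr a q : cauchy_eq a (qrepr (Rrat q)) (cconst q).
Proof. exact: cauchy_eq_le (lex1 a) (repr_Rclass _). Qed.

Lemma Rrat_pos q : 0 < q -> Rpos (Rrat q).
Proof.
move=> q0; apply: between_Rlt => c c0; exists c, 0, q; split=> //; split.
  exact/cauchy_eq_leW/(Rrat_repr c 0).
exact/cauchy_eq_leW/cauchy_eq_sym/Rrat_repr.
Qed.

Lemma Rpos_rat (e : condR A \top) c : Rpos e -> c != \bot%O ->
  exists (c' : A) q, [/\ c' != \bot%O, (c' <= c)%O, 0 < q & cauchy_le c' (cconst q) (qrepr e)].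
Proof.
move=> e0 c0; have [c' [p [q [c'0 cc pq [p0 qe]]]]] := Rlt_between e0 c0.
exists c', q; split=> //; apply: le_lt_trans pq.
apply: (cconst_le_inv c'0); apply: cauchy_le_trans p0.
exact/cauchy_eq_leW/cauchy_eq_sym/(Rrat_repr c' 0).
Qed.

End Reals.

(** * Rational balls and open sets *)

Section Metric.
Context d (A : completeBoolType d) (X : condSet A) (D : condMetric X).
Implicit Types (a b c : A) (x y z l : X \top) (U V : csub X) (p q r : rat).

(** Stated on representatives because [Rle] compares on [\top] only. *)
Definition dist_le a q x y := cauchy_le a (qrepr (cdist D x y)) (cconst A q).

Lemma dist_le_le a b q x y : a <= b -> dist_le b q x y -> dist_le a q x y.
Proof. exact: cauchy_le_mono. Qed.

Lemma dist_le_gam a q x x' y y' : gam a x = gam a x' -> gam a y = gam a y' ->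
  dist_le a q x y -> dist_le a q x' y'.
Proof.
move=> xx yy; apply: cauchy_le_eq; last exact: cauchy_eq_refl.
exact/Rgam_repr/cdist_gam.
Qed.

Lemma dist_le_sym a q x y : dist_le a q x y -> dist_le a q y x.
Proof. by rewrite /dist_le /cdist cdistC. Qed.

Lemma dist_le_mono a p q x y : (p <= q)%R -> dist_le a p x y -> dist_le a q x y.
Proof. by move=> pq H; apply: cauchy_le_trans H (cconst_le a pq). Qed.

Lemma dist_le_refl a q x : (0 <= q)%R -> dist_le a q x x.
Proof.
move=> q0; apply: dist_le_mono q0 _; rewrite /dist_le /cdist (cdist0 D x x).2 //.
exact/cauchy_eq_leW/(Rrat_repr a 0%R).
Qed.

Lemma dist_le_trans a p q x y z : dist_le a p x y -> dist_le a q y z -> dist_le a (p + q)%R x z.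
Proof.
move=> xy yz.
have := cauchy_le_mono (lex1 a) (cdist_triangle D x y z) => /cauchy_le_trans; apply.
apply: cauchy_le_trans (cauchy_eq_leW (cauchy_eq_le (lex1 a) (repr_Rclass _))) _.
exact: cauchy_le_trans (cauchy_le_add xy yz) (cconst_add _ _ _).
Qed.

Lemma dist_le_Rle q x y : Rle (cdist D x y) (Rrat A q) <-> dist_le \top q x y.
Proof.
split=> H; first exact: cauchy_le_trans H (cauchy_eq_leW (Rrat_repr _ _)).
exact: cauchy_le_trans H (cauchy_eq_leW (cauchy_eq_sym (Rrat_repr _ _))).
Qed.

Lemma inon_ballP a x z e (e0 : Rpos e) : inon a z (cball D x e0) <->
  exists2 y, Rlt (cdist D x y) e & gam a y = gam a z.
Proof.
split=> [[_ [y yP yz]]|[y yP yz]].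
  by exists y => //; rewrite -yz /cres clift_top.
by split; [exact: lex1 | exists y => //; rewrite /cres clift_top].
Qed.

Lemma ball_in a p q x z e (e0 : Rpos e) : dist_le a p x z -> (p < q)%R ->
  cauchy_le a (cconst A q) (qrepr e) -> inon a z (cball D x e0).
Proof.
move=> xz pq qe; have [w [wz wx]] := mix a z x.
apply/inon_ballP; exists w => //; apply: between_Rlt => c c0.
have [ca|ca] := eqVneq (c `&` a) \bot; last first.
  exists (c `&` a), p, q; split=> //; first exact: leIl.
  split; last exact: cauchy_le_mono (leIr _ _) qe.
  by apply: dist_le_gam (dist_le_le (leIr _ _) xz) => //; apply: gam_cons (leIr _ _) (esym wz).
have cna : c <= ~` a by rewrite -disj_leC ca eqxx.
have [c' [r [c'0 cc r0 re]]] := Rpos_rat e0 c0.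
exists c', 0%R, r; split=> //; split=> //.
apply: (@dist_le_gam _ _ x x x) => //; last exact: dist_le_refl.
by apply: gam_cons (esym wx); chain.
Qed.

(** Half of a rational gap between the distance and [e] serves as radius around [z]. *)
Lemma ball_open a x z e (e0 : Rpos e) : a != \bot -> inon a z (cball D x e0) ->
  exists c r, [/\ c != \bot, c <= a, (0 < r)%R &
    forall c' z', c' <= c -> dist_le c' r z z' -> inon c' z' (cball D x e0)].
Proof.
move=> a0 /inon_ballP[y xy yz].
have [c [p [q [c0 ca pq [xp qe]]]]] := Rlt_between xy a0.
exists c, ((q - p) / 2)%R; split=> //; first lra.
move=> c' z' cc zz; apply: (@ball_in _ (p + (q - p) / 2)%R q); last exact: cauchy_le_mono cc qe.
  apply: dist_le_trans zz; apply: (@dist_le_gam _ _ x x y) => //; last exact: dist_le_le cc xp.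
  by apply: gam_cons yz; chain.
lra.
Qed.

Definition rball x q (q0 : (0 < q)%R) := cball D x (Rrat_pos A q0).

Lemma rball_in a p q x z (q0 : (0 < q)%R) : dist_le a p x z -> (p < q)%R ->
  inon a z (rball x q0).
Proof.
move=> xz pq; apply: ball_in xz pq _.
exact/cauchy_eq_leW/cauchy_eq_sym/Rrat_repr.
Qed.

Lemma rball_dist_le a q x z (q0 : (0 < q)%R) : inon a z (rball x q0) -> dist_le a q x z.
Proof.
move=> /inon_ballP[y [/dist_le_Rle xy _] yz].
by apply: dist_le_gam (dist_le_le (lex1 a) xy).
Qed.

(** A rational radius costs the passage to a smaller [c], since a positive conditional real has
    positive rationals below it only piecewise. *)
Definition locally_open U := forall a z, a != \bot -> inon a z U ->
  exists c r, [/\ c != \bot, c <= a, (0 < r)%R &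
    forall c' z', c' <= c -> dist_le c' r z z' -> inon c' z' U].

Lemma inon_czero a z : inon a z (czero X) <-> a = \bot.
Proof.
split=> [[a0 _]|->]; last exact: inon_bot.
by apply/eqP; rewrite -lex0.
Qed.

Lemma locally_open_ctopology : is_ctopology locally_open.
Proof.
split.
- by move=> a z /eqP a0 /inon_czero.
- by move=> a z a0 _; exists a, 1%R; split=> // c' z' _ _; apply: inon_cfull.
- move=> I a O U pa HO HU b z b0 bU; have [i [e [e0 eb ea]]] := cpart_force pa b0 (lex1 _).
  have /(HO i)[//|c [r [c0 ce r0 H]]] : inon e z (O i).
    have : inon e z (crestr (a i) U) by apply/inon_crestr; split=> //; apply: inon_le bU.
    by rewrite HU => /inon_crestr[].
  exists c, r; split=> //; first by chain.
  move=> c' z' cc zz; have : inon c' z' (crestr (a i) (O i)).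
    by apply/inon_crestr; split; [chain | apply: H].
  by rewrite -HU => /inon_crestr[].
- move=> U V HU HV a z a0 /inon_cmeet[aU aV].
  have [b [r [b0 ba r0 Hb]]] := HU _ _ a0 aU.
  have [c [s [c0 cb s0 Hc]]] := HV _ _ b0 (inon_le ba aV).
  exists c, (Num.min r s); split=> //; first by chain.
    by rewrite lt_min r0.
  move=> c' z' cc zz; apply/inon_cmeet; split.
    by apply: Hb; [chain | apply: dist_le_mono zz; rewrite ge_min lexx].
  by apply: Hc => //; apply: dist_le_mono zz; rewrite ge_min lexx orbT.
- move=> K O HO a z a0 /inon_cjoin/(csup_force a0)[b [e [[k bk] e0 ea eb]]].
  have [c [r [c0 ce r0 Hc]]] := HO k _ _ e0 (inon_le eb bk).
  exists c, r; split=> //; first by chain.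
  by move=> c' z' cc zz; apply/inon_cjoin/csup_ub; exists k; apply: Hc.
Qed.

(** The restriction is the gluing of [U] on [a] with the zero set on the complement of [a]. *)
Lemma ctopology_crestr (T : set (csub X)) a U : is_ctopology T -> T U -> T (crestr a U).
Proof.
move=> [T0 _ Tglue _ _] TU.
apply: (Tglue _ _ (fun i : bool => if i then U else czero X) _ (cpart_bool a)).
  by case.
case; apply: csub_eq => b z; split=> /inon_crestr[ba].
- by move=> /inon_crestr[_ bU]; apply/inon_crestr.
- by move=> bU; apply/inon_crestr; split=> //; apply/inon_crestr.
- move=> /inon_crestr[ba' _]; apply/inon_crestr; split=> //; apply/inon_czero.
  by apply/eqP; rewrite -lex0 -(meetxC a) lexI ba' ba.
- by move=> /inon_czero ->; apply: inon_bot.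
Qed.

(** Locally open sets form a topology containing the balls, hence contain the generated one.
    Conversely, [U] is the join of all restricted rational balls inside it. *)
Lemma copenP U : copen D U <-> locally_open U.
Proof.
split=> [H|HU T TT Tball].
  by apply: H; [exact: locally_open_ctopology | move=> x e e0 a z; apply: ball_open].
pose B (k : A * (X \top) * {q : rat | (0 < q)%R}) := crestr k.1.1 (rball k.1.2 (svalP k.2)).
have -> : U = cjoin (fun k : {k | csubset (B k) U} => B (sval k)).
  apply: csubset_anti; last by apply: cjoin_least => -[k].
  apply/csubsetP => a z aU; apply/inon_cjoin/force_le => c c0 ca.
  have [e [r [e0 ec r0 He]]] := HU _ _ c0 (inon_le ca aU).
  exists e => //; rewrite ec; pose k := (e, z, exist (fun q => is_true (0 < q)%R) r r0).
  have Bk : csubset (B k) U.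
    apply/csubsetP => b y /inon_crestr[be yB]; apply: He be _; exact: rball_dist_le yB.
  apply: csup_ub; exists (exist _ k Bk); apply/inon_crestr; split=> //.
  by apply: (@rball_in _ 0%R) => //; apply: dist_le_refl.
case: (TT) => _ _ _ _; apply => -[k kU]; apply: ctopology_crestr => //; exact: Tball.
Qed.

Lemma cnbhd_rball x q (q0 : (0 < q)%R) : cnbhd D x (rball x q0).
Proof.
exists (rball x q0); split; last by apply/csubsetP.
  by apply/copenP => a z; apply: ball_open.
by apply: (@rball_in _ 0%R) => //; apply: dist_le_refl.
Qed.

End Metric.

(** * Conditional sequences and finite nets *)

Section Sequences.
Context d (A : completeBoolType d) (X : condSet A).
Implicit Types (a b c : A) (n m : condN A \top) (k : nat).

Definition nconst k : condN A \top := gconst A 0%N k.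

Lemma gam_nconst c n k : c <= gval n k -> gam c n = gam c (nconst k).
Proof.
move=> cn; apply/gen_gamP => e p e0 ec ep.
by rewrite (gval_uniq e0 ep (le_trans ec cn)) gconst_le.
Qed.

Lemma gam_force b (x y : X \top) :
  (forall c, c != \bot -> c <= b -> exists e, [/\ e != \bot, e <= c & gam e x = gam e y]) ->
  gam b x = gam b y.
Proof.
move=> H; have [||I [a [pa aP]]] := @dense_part _ A (fun e => gam e x = gam e y) b.
- by move=> a c ac; apply: gam_cons.
- by [].
exact: gam_eq pa aP.
Qed.

Lemma cpart_prod (I J : Type) b (a : I -> A) (a' : J -> A) : cpart b a -> cpart b a' ->
  cpart b (fun ij : I * J => a ij.1 `&` a' ij.2).
Proof.
move=> pa pa'; apply: cpartP => [[i j]|c c0 cb|].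
- exact: le_trans (leIl _ _) (cpart_le i pa).
- have [i [e [e0 ec ea]]] := cpart_force pa c0 cb.
  have [j [f [f0 fe fa]]] := cpart_force pa' e0 (le_trans ec cb).
  exists (i, j) => //; apply: neq0_le f0 _.
  by rewrite !lexI fa (le_trans fe ec) (le_trans fe ea).
move=> [i j] [i' j'] c c0 /=; rewrite !lexI => /andP[ci cj] /andP[ci' cj'].
by rewrite (cpart_uniq pa c0 ci ci') (cpart_uniq pa' c0 cj cj').
Qed.

(** The value at [n] is glued along the common refinement of [a] and the partition on which [n]
    takes ordinary values. *)
Lemma glue_seq (I : Type) (a : I -> A) (x : I -> nat -> X \top) : cpart \top a ->
  exists f : condFun (condN A) X, forall n i k c, c <= a i -> c <= gval n k ->
    gam c (f n) = gam c (x i k).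
Proof.
move=> pa; have pn n := cpart_prod pa (gval_part n).
have /choice[f fP] n := glue_exists (fun ik => x ik.1 ik.2) (pn n).
have {}fP n i k c : c <= a i -> c <= gval n k -> gam c (f n) = gam c (x i k).
  by move=> ci ck; apply: (gam_cons _ (fP n (i, k))); rewrite lexI ci.
have fc b n m : gam b n = gam b m -> gam b (f n) = gam b (f m).
  move=> nm; apply: gam_force => c c0 cb.
  have [[i k] [e [e0 ec]]] := cpart_force (pn n) c0 (lex1 _).
  rewrite lexI /= => /andP[ei en]; exists e; split=> //.
  by rewrite (fP n i k) // (fP m i k) //; apply: gam_gval nm e0 _ en; chain.
by exists (condfun_of fc) => n i k c; rewrite condfun_ofE; apply: fP.
Qed.

Lemma seq_of (x : nat -> X \top) : exists f : condFun (condN A) X,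
  forall n k c, c <= gval n k -> gam c (f n) = gam c (x k).
Proof.
have p1 : cpart \top (fun _ : unit => \top : A).
  by apply: cpartP => [i|c c0 _|[] []] //; exists tt => //; rewrite meetx1.
have [f fP] := glue_seq (fun=> x) p1.
by exists f => n k c; apply: (fP n tt); apply: lex1.
Qed.

Definition nle_on a n m := grel_on (fun i j : nat => (i <= j)%N) a n m.

Lemma nconst_le n k c j : Nle (nconst k) n -> c != \bot -> c <= gval n j -> (k <= j)%N.
Proof. by move=> /Nle_force H c0; apply: H => //; apply: gconst_le. Qed.

Lemma Nmax_val n k c j : c <= gval n j -> c <= gval (Nmax n (nconst k)) (maxn j k).
Proof. by move=> cn; apply: glift2_in => //; apply: gconst_le. Qed.

Lemma Nmax_ge n m : Nle n (Nmax n m).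
Proof. by case: (@Nle_max _ A n m (Nmax n m) (@Nle_refl _ _ _)). Qed.

End Sequences.

Section Points.
Context d (A : completeBoolType d) (X : condSet A) (D : condMetric X).
Implicit Types (a b c e : A) (x y z l : X \top) (p q r : rat) (k : nat)
  (s : condFun (condN A) X) (f : nat -> X \top).
Local Notation dist_le := (dist_le D).

Lemma dist_le_force a q x y : (forall c, c != \bot -> c <= a ->
    exists e, [/\ e != \bot, e <= c & dist_le e q x y]) -> dist_le a q x y.
Proof.
move=> H; have [||I [b [pb bP]]] := @dense_part _ A (fun e => dist_le e q x y) a => //.
  by move=> b c; apply: dist_le_le.
exact: cauchy_le_part pb bP.
Qed.

(** The number [k] of centres is ordinary, but the centre close to [z] may change from piece to
    piece. *)
Definition net_on c q k f := forall z b, b != \bot -> b <= c ->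
  exists e j, [/\ e != \bot, e <= b, (j < k)%N & dist_le e q (f j) z].

(** Total boundedness freed of conditional indices and radii; the equivalence is
    [totally_bounded_nets] with [nets_totally_bounded]. *)
Definition finite_nets := forall q, (0 < q)%R -> forall c, c != \bot ->
  exists e k f, [/\ e != \bot, e <= c & net_on e q k f].

Lemma net_on_le b c q k f : b <= c -> net_on c q k f -> net_on b q k f.
Proof. by move=> bc H z a a0 ab; apply: H => //; chain. Qed.

Section SegmentElements.
Variables (n : condN A \top) (n1 : Nle (gconst A 0%N 1%N) n).

(** The constant index [j.+1] may exceed [n] on some pieces; truncation at [n] puts it into the
    segment without changing it where it fits. *)
Lemma segment_min j : segment_set n (glift2 0%N minn (nconst A j.+1) n).
Proof.
split; apply/Nle_force => c p q c0.
  move=> /(gconst_val c0) -> /(glift2_force c0)[i [i' [e [e0 ec]]]].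
  move=> /(gconst_val e0) -> ei <-; rewrite leq_min /=.
  exact: nconst_le n1 e0 ei.
move=> /(glift2_force c0)[i [i' [e [e0 ec _ ei <-]]]] cq.
by rewrite (gval_uniq e0 ei (le_trans ec cq)) geq_minr.
Qed.

Lemma segment_min_val c j k : (j < k)%N -> c <= gval n k ->
  c <= gval (glift2 0%N minn (nconst A j.+1) n : condN A \top) j.+1.
Proof.
move=> jk ck; rewrite -{2}(minn_idPl jk); apply: glift2_in => //.
exact: gconst_le.
Qed.

Definition segment_el m (nm : segment_set n m) : segment n1 \top :=
  exist _ m (ex_intro2 _ _ m nm (gam_top m)).

Lemma segment_elP (k : segment n1 \top) : segment_set n (sval k).
Proof. by case: k => m [m' nm mE] /=; rewrite -mE; have -> := gam_top m'. Qed.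

Lemma segment_gam c (k k' : segment n1 \top) :
  gam c (sval k) = gam c (sval k') -> gam c k = gam c k'.
Proof. by move=> kk; apply: eq_exist. Qed.

End SegmentElements.

(** Where [n] has an ordinary value [k], each index of the segment is piecewise one of 1, ..., [k],
    so [k] points suffice. Net indices start at 0, hence the shift to [j.-1]. *)
Lemma totally_bounded_nets : ctotally_bounded D -> finite_nets.
Proof.
move=> H q q0 c c0; have [n [n1 [x /csubsetP xP]]] := H _ (Rrat_pos A q0).
have [k [e [e0 ec ek]]] := gval_force n c0.
exists e, k, (fun j => x (segment_el n1 (segment_min n1 j))); split=> // z b b0 be.
have /inon_cjoin/(csup_force b0)[b1 [b' [[i iz] b'0 b'b b'i]]] := xP b z (inon_cfull _ _).
have {}iz := inon_le b'i iz.
have [j [e' [e'0 e'b e'j]]] := gval_force (sval i) b'0.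
have [i1 i2] := segment_elP i.
have j0 : (0 < j)%N by apply: nconst_le i1 e'0 e'j.
have jk : (j <= k)%N.
  by move/Nle_force: i2; apply; [exact: e'0 | exact: e'j | chain].
exists e', j.-1; split=> //; [by chain | by rewrite prednK |].
apply: dist_le_gam (dist_le_le e'b (rball_dist_le iz)) => //.
apply/gam_capp/segment_gam; rewrite (gam_nconst e'j); apply/esym/gam_nconst.
by case: j j0 jk {e'j} => // j _ jk; apply: segment_min_val jk _; chain.
Qed.

Lemma nets_totally_bounded : finite_nets -> ctotally_bounded D.
Proof.
move=> H e e0.
(* Balls are strict, so the net is taken at [q / 2] to stay strictly below [q]. *)
pose P c := exists q k f, [/\ (0 < q)%R, cauchy_le c (cconst A q) (qrepr e) &
  net_on c (q / 2)%R k f].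
have [||I [a [pa aP]]] := @dense_part _ A P \top.
- move=> a c ac [q [k [f [q0 qe fP]]]]; exists q, k, f; split=> //.
    exact: cauchy_le_mono ac qe.
  exact: net_on_le ac fP.
- move=> c c0 _; have [c' [q [c'0 cc q0 qe]]] := Rpos_rat e0 c0.
  have [b [k [f [b0 bc fP]]]] := H (q / 2)%R ltac:(lra) _ c'0.
  exists b; split=> //; first by chain.
  by exists q, k, f; split=> //; exact: cauchy_le_mono bc qe.
move: aP => /choice[q /choice[k /choice[f fP]]].
(* The successor ensures [n >= 1] even on pieces whose net is empty. *)
have [n nP] := glue_exists (fun i => nconst A (k i).+1) pa.
have nk i c : c <= a i -> c <= gval n (k i).+1.
  have [->|c0] := eqVneq c \bot; first by rewrite le0x.
  by move=> ci; apply: gam_gval (esym (nP i)) c0 ci (gconst_le _ _ _).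
have n1 : Nle (gconst A 0%N 1%N) n.
  apply/Nle_force => c p j c0 /(gconst_val c0) -> cj.
  have [i [b [b0 bc bi]]] := cpart_force pa c0 (lex1 _).
  by rewrite (gval_uniq b0 (le_trans bc cj) (nk i b bi)).
have [F FP] := glue_seq (fun i j => f i j.-1) pa.
have FsP c (u v : segment n1 \top) : gam c u = gam c v -> gam c (F (sval u)) = gam c (F (sval v)).
  by move=> /(congr1 sval) uv; apply: gam_capp.
exists n, n1, (condfun_of FsP); apply/csubsetP => b z _; apply/inon_cjoin/force_le => c c0 cb.
have [i [c' [c'0 cc ci]]] := cpart_force pa c0 (lex1 _).
have [q0 qe /(_ z c' c'0 ci)[b' [j [b'0 b'c jk jz]]]] := fP i.
exists b' => //; have -> /= : b' <= c by chain.
pose u := segment_el n1 (segment_min n1 j).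
have ju : gam b' (f i j) = gam b' (condfun_of FsP u).
  rewrite condfun_ofE; apply/esym/(FP _ i j.+1); first by chain.
  by apply: (@segment_min_val n _ j (k i).+1); [exact: ltnW | apply: nk; chain].
apply: csup_ub; exists u; apply: (@ball_in _ _ _ _ _ (q i / 2)%R (q i)).
- exact: dist_le_gam ju erefl jz.
- by lra.
- by apply: cauchy_le_mono qe; chain.
Qed.

End Points.

(** * Sequential compactness implies completeness and total boundedness *)

Section Convergence.
Context d (A : completeBoolType d) (X : condSet A) (D : condMetric X).
Implicit Types (a b c e : A) (x y z l : X \top) (p q r : rat) (k : nat)
  (s : condFun (condN A) X) (f : nat -> X \top).
Local Notation dist_le := (dist_le D).
Local Notation nconst := (nconst A).

(** One late term within [r / 2] of [l] brings all later terms within [r]. The radius [r] depends on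
    the piece, so the thresholds are glued. *)
Lemma cauchy_cluster_converges s l : ccauchy D s -> ccluster D s l -> cconverges D s l.
Proof.
move=> sC sl U [O [/copenP Oo Ol /csubsetP OU]].
pose P c n := inon c (s n) O.
have [||I [a [pa aP]]] := @dense_part _ A
    (fun c => exists n0, forall n, Nle n0 n -> P c n) \top.
- by move=> a c ac [n0 n0P]; exists n0 => n /n0P; apply: inon_le.
- move=> c c0 c1; have [c' [r [c'0 cc r0 H]]] := Oo _ _ c0 (inon_le c1 Ol).
  exists c'; split=> //; have r2 : (0 < r / 2)%R by lra.
  have [n0 n0P] := sC _ (Rrat_pos A r2); exists n0 => n nn.
  have [m [mm sm]] := sl _ (cnbhd_rball D l r2) n0.
  have /dist_le_Rle mn := n0P _ _ mm nn; have lm := rball_dist_le sm.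
  apply: H => //; apply: dist_le_le (lex1 _) _.
  by apply: dist_le_mono (dist_le_trans lm mn); lra.
have [||n0 n0P] := @tail_glue1 _ A I a P pa.
- by move=> b n n' nn; apply: inon_gam; apply: gam_capp.
- exact: aP.
by exists n0 => n /n0P nP; apply: OU; apply: inon_glue pa nP.
Qed.

Lemma converges_dist_le s l q : cconverges D s l -> (0 < q)%R ->
  exists n0, forall n, Nle n0 n -> dist_le \top q l (s n).
Proof.
move=> H q0; have [n0 n0P] := H _ (cnbhd_rball D l q0).
by exists n0 => n /n0P; apply: rball_dist_le.
Qed.

Lemma seq_compact_complete : cseq_compact D -> ccomplete D.
Proof.
by move=> H s sC; have [l sl] := H s; exists l; apply: cauchy_cluster_converges.
Qed.

Lemma seq_compact_nets : cseq_compact D -> finite_nets D.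
Proof.
move=> SC q q0 c c0; apply: contrapT => H.
(* Separation on every nonzero [b <= a] makes this property local; since no net exists below [c], it
   is satisfiable densely, hence on all of [c]. *)
pose far k f a z := forall j b, (j < k)%N -> b != \bot -> b <= a -> ~ dist_le b q (f j) z.
have /choice[g gP] : forall kf : nat * (nat -> X \top), exists z, far kf.1 kf.2 c z.
  move=> [k f] /=; apply: dense_exists.
  - by move=> a b z ab F j e jk e0 ea; apply: F => //; chain.
  - move=> a z z' zz F j e jk e0 ea fz; apply: (F j e) => //.
    by apply: dist_le_gam fz => //; apply: gam_cons ea (esym zz).
  - move=> I b a z pa F j e jk e0 eb fz.
    have [i [e' [e'0 e'e ei]]] := cpart_force pa e0 eb.
    by apply: (F i j e') => //; apply: dist_le_le fz.
  - move=> b b0 bc; apply: contrapT => F; apply: H; exists b, k, f; split=> // z a a0 ab.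
    apply: contrapT => F'; apply: F; exists a, z; split=> // j e jk e0 ea fz.
    by apply: F'; exists e, j.
have [z0 _] := carr_bot X; have {}z0 := clift z0.
(* Course-of-values recursion: [G n] stores the first [n] terms, and [g] picks the next one far from
   all of them. *)
pose G := fix G n : nat -> X \top := if n is n'.+1 then
  fun i => if (i < n')%N then G n' i else g (n', G n') else fun=> z0.
pose x n := g (n, G n).
have Gx n i : (i < n)%N -> G n i = x i.
  elim: n => // n IH; rewrite ltnS leq_eqVlt /= => /orP[/eqP ->|ni].
    by rewrite ltnn.
  by rewrite ni IH.
have xfar i j b : (i < j)%N -> b != \bot -> b <= c -> ~ dist_le b q (x i) (x j).
  by move=> ij b0 bc; rewrite -(Gx j i ij); apply: (gP (j, G j)).
have [s sP] := seq_of x; have [l sl] := SC s; have q2 : (0 < q / 2)%R by lra.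
have [m1 [_ /rball_dist_le lm1]] := sl _ (cnbhd_rball D l q2) (nconst 0).
have [k1 [c1 [c10 c1c ck1]]] := gval_force m1 c0.
(* The bound [k1.+1] makes the second index strictly larger; two terms within [q / 2] of [l] then
   contradict [xfar]. *)
have [m2 [/nconst_le m2k /rball_dist_le lm2]] := sl _ (cnbhd_rball D l q2) (nconst k1.+1).
have [k2 [c2 [c20 c21 ck2]]] := gval_force m2 c10.
apply: (xfar k1 k2 c2) => //; [exact: m2k c20 ck2 | chain |].
have -> : q = (q / 2 + q / 2)%R by lra.
apply: (@dist_le_trans _ _ _ _ _ _ _ _ l).
  apply: dist_le_sym; apply: dist_le_gam (dist_le_le (lex1 _) lm1) => //.
  by apply: sP; chain.
apply: dist_le_gam (dist_le_le (lex1 _) lm2) => //; exact: sP.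
Qed.

Lemma pow2_small q : (0 < q)%R -> exists K, forall k, (K <= k)%N -> ((2%:R ^- k : rat) <= q)%R.
Proof.
move=> q0; exists (Num.Def.archi_bound q^-1) => k /upper_nthrootP qk.
rewrite -[leRHS]invrK lef_pV2 ?posrE ?invr_gt0 ?exprn_gt0 //; exact: ltW.
Qed.

(** Any positive [e] dominates a positive rational on each piece of a partition, along which the
    thresholds glue. *)
Lemma cauchy_of_rat s :
  (forall q, (0 < q)%R -> exists n0, forall n m, Nle n0 n -> Nle n0 m ->
    dist_le \top q (s n) (s m)) ->
  ccauchy D s.
Proof.
move=> H e e0; pose P c n m := cauchy_le c (qrepr (cdist D (s n) (s m))) (qrepr e).
have [||I [a [pa aP]]] := @dense_part _ A
  (fun c => exists q, (0 < q)%R /\ cauchy_le c (cconst A q) (qrepr e)) \top.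
- by move=> a c ac [q [q0 qe]]; exists q; split=> //; apply: cauchy_le_mono ac qe.
- by move=> c c0 _; have [c' [q [*]]] := Rpos_rat e0 c0; exists c'; split=> //; exists q.
have [||n0 n0P] := @tail_glue _ A I a P pa.
- move=> b n n' m m' nn mm; apply: cauchy_le_eq; last exact: cauchy_eq_refl.
  by apply/Rgam_repr/cdist_gam; apply: gam_capp.
- move=> i; have [q [q0 qe]] := aP i; have [n0 n0P] := H q q0; exists n0 => n m nn mm.
  exact: cauchy_le_trans (dist_le_le (lex1 _) (n0P _ _ nn mm)) qe.
by exists n0 => n m nn mm; apply: cauchy_le_part pa (n0P n m nn mm).
Qed.

End Convergence.

(** * Completeness and total boundedness imply compactness *)

Section HeineBorel.
Context d (A : completeBoolType d) (X : condSet A) (D : condMetric X).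
Variables (J : condSet A) (O : condFun J (powC X)).
Implicit Types (a b c e : A) (x y z l : X \top) (p q r : rat) (k : nat)
  (W : A -> X \top -> Prop).
Local Notation dist_le := (dist_le D).

(** [W] is a region given locally: [W b z] reads as [z] lying in it on [b]. The member of [F] that
    covers [z] may vary with the piece. *)
Definition fin_on c W := exists F : set (J \top), finite_set F /\
  forall z b, b != \bot -> b <= c -> W b z ->
    exists e j, [/\ e != \bot, e <= b, F j & inon e z (sval (O j))].

(** Forcing negation: plain failure on [c] would still allow finite subcovers on smaller
    elements. *)
Definition nowhere_fin_on c W := forall b, b != \bot -> b <= c -> ~ fin_on b W.

Lemma fin_on_sub b c W W' : b <= c -> (forall e z, e <= b -> W' e z -> W e z) ->
  fin_on c W -> fin_on b W'.
Proof.
move=> bc WW [F [Ff FP]]; exists F; split=> // z e e0 eb We.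
by apply: FP => //; [chain | apply: WW].
Qed.

Lemma nowhere_fin_on_sub c W W' : (forall e z, e <= c -> W' e z -> W e z) ->
  nowhere_fin_on c W' -> nowhere_fin_on c W.
Proof.
move=> WW H b b0 bc Wb; apply: (H b) => //; apply: fin_on_sub Wb => // e z eb.
by apply: WW; chain.
Qed.

(** A region without points on any nonzero element below [b] would be covered by the empty
    family. *)
Lemma nowhere_fin_on_inhabited c W : nowhere_fin_on c W -> forall b, b != \bot -> b <= c ->
  exists e z, [/\ e != \bot, e <= b & W e z].
Proof.
move=> H b b0 bc; apply: contrapT => N; apply: (H b) => //.
exists set0; split; first exact: finite_set0.
by move=> z e e0 eb We; case: N; exists e, z.
Qed.

(** If the part of [W] near each centre of a finite net had finite subcovers densely, their union
    would cover [W] on a common piece. So a bad centre exists densely, and bad centres glue. *)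
Lemma nowhere_fin_on_step c W q : finite_nets D -> (0 < q)%R ->
  (forall a b z, a <= b -> W b z -> W a z) -> nowhere_fin_on c W ->
  exists x, nowhere_fin_on c (fun b z => W b z /\ dist_le b q x z).
Proof.
move=> FC q0 Wle Wc.
apply: (@dense_exists _ A X (fun a x => nowhere_fin_on a (fun b z => W b z /\ dist_le b q x z)) c).
- by move=> a b x ab H e e0 ea; apply: (H e) => //; chain.
- move=> a x x' xx; apply: nowhere_fin_on_sub => e z ea [Wz xz]; split=> //.
  by apply: dist_le_gam xz => //; apply: gam_cons ea xx.
- move=> I b a x pa H e e0 eb; have [i [e' [e'0 e'e ei]]] := cpart_force pa e0 eb.
  by move=> fe; apply: (H i e') => //; apply: fin_on_sub e'e _ fe.
move=> b b0 bc; have [e [k [f [e0 eb fP]]]] := FC q q0 b b0.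
apply: contrapT => N.
have {}N j a : a != \bot -> a <= e -> exists a', [/\ a' != \bot, a' <= a &
    fin_on a' (fun b z => W b z /\ dist_le b q (f j) z)].
  move=> a0 ae; apply: contrapT => N'; apply: N; exists a, (f j); split=> //.
    by chain.
  by move=> a' a'0 a'a fa; apply: N'; exists a'.
(* Induction on the number of centres; each one shrinks the piece once more and adds its finite
   family. *)
have [e' [e'0 e'e [F [Ff FP]]]] : exists a', [/\ a' != \bot, a' <= e &
    fin_on a' (fun b z => W b z /\ exists2 j, (j < k)%N & dist_le b q (f j) z)].
  elim: {fP}k => [|k [a [a0 ae [F [Ff FP]]]]].
    by exists e; split=> //; exists set0; split=> // z a a0 ae [_ []].
  have [a' [a'0 a'a [F' [F'f F'P]]]] := N k a a0 ae.
  exists a'; split=> //; first by chain.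
  exists (F `|` F')%classic; split; first by rewrite finite_setU.
  move=> z c' c'0 c'a [Wz [j]]; rewrite ltnS leq_eqVlt => /orP[/eqP ->|jk] jz.
    have [e' [i [*]]] := F'P z c' c'0 c'a (conj Wz jz).
    by exists e', i; split=> //; right.
  have [||e' [i [*]]] := FP z c' c'0 _ (conj Wz _); [by chain | by exists j |].
  by exists e', i; split=> //; left.
apply: (Wc e') => //; first by chain.
exists F; split=> // z a a0 ae' Wz.
have [|a' [j [a'0 a'a jk jz]]] := fP z a a0; first by chain.
have [||e'' [i [*]]] := FP z a' a'0 _ (conj (Wle _ _ _ a'a Wz) _).
- by chain.
- by exists j.
by exists e'', i; split=> //; chain.
Qed.

Hypotheses (Oopen : forall j, copen D (sval (O j)))
  (Ocover : csubset (cfull X) (cjoin (fun j : J \top => sval (O j)))).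

Lemma fin_on_dense c : ccomplete D -> finite_nets D -> c != \bot ->
  exists b, [/\ b != \bot, b <= c & fin_on b (fun _ _ => True)].
Proof.
move=> cX FC c0; apply: contrapT => N.
have {N}bad0 : nowhere_fin_on c (fun _ _ => True) by move=> b b0 bc fb; apply: N; exists b.
pose rad k : rat := (2%:R ^- k)%R.
have rad0 k : (0 < rad k)%R by rewrite invr_gt0 exprn_gt0.
have radS k : (rad k = rad k.+1 + rad k.+1)%R.
  by rewrite /rad exprSr invfM; apply: splitr.
pose B k x b z := dist_le b (rad k) x z.
have Ble k x a b z : a <= b -> B k x b z -> B k x a z by apply: dist_le_le.
(* Badness is kept as a premise inside so that the choice of the next centre is a total function. *)
have /choice[g gP] : forall kx : nat * X \top, exists x', nowhere_fin_on c (B kx.1 kx.2) ->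
    nowhere_fin_on c (fun b z => B kx.1 kx.2 b z /\ B kx.1.+1 x' b z).
  move=> [k x] /=; have [Bk|nBk] := pselect (nowhere_fin_on c (B k x)); last by exists x.
  by have [x' x'P] := nowhere_fin_on_step FC (rad0 k.+1) (@Ble k x) Bk; exists x'.
have [x0 x0P] := @nowhere_fin_on_step c (fun _ _ => True) _ FC (rad0 0%N) (fun _ _ _ _ h => h) bad0.
pose x := fix x k := if k is k'.+1 then g (k', x k') else x0.
have xbad k : nowhere_fin_on c (B k (x k)).
  elim: k => [|k IH]; first by apply: nowhere_fin_on_sub x0P => e z _ [].
  by apply: nowhere_fin_on_sub (gP (k, x k) IH) => e z _ [].
(* Consecutive balls meet densely, because their common part has no finite subcover and so is
   inhabited. *)
have xS k : dist_le c (rad k + rad k.+1)%R (x k) (x k.+1).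
  apply: dist_le_force => b b0 bc.
  have [e [z [e0 eb [kz k1z]]]] := nowhere_fin_on_inhabited (gP (k, x k) (xbad k)) b0 bc.
  by exists e; split=> //; apply: dist_le_trans kz (dist_le_sym k1z).
have xD k m : (k <= m)%N -> dist_le c (3%:R * rad k)%R (x k) (x m).
  move=> /subnK <-; move: (m - k)%N => j.
  (* The sharper bound telescopes, as [rad k + rad k.+1 = 3 * (rad k - rad k.+1)]. *)
  suff H : dist_le c (3%:R * rad k - 3%:R * rad (j + k)%N)%R (x k) (x (j + k)%N).
    by apply: dist_le_mono H; have := rad0 (j + k)%N; lra.
  elim: j => [|j IH]; first by apply: dist_le_refl; rewrite subrr.
  by apply: dist_le_mono (dist_le_trans IH (xS _)); have := radS (j + k)%N; rewrite addSn; lra.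
(* outside c the sequence is made constant, so that it is Cauchy everywhere *)
have /choice[y yP] k := mix c (x k) x0.
have yD k m : (k <= m)%N -> dist_le \top (3%:R * rad k)%R (y k) (y m).
  move=> km; apply: dist_le_force => b b0 _.
  have [bc|bc] := eqVneq (b `&` c) \bot; last first.
    exists (b `&` c); split=> //; first exact: leIl.
    apply: dist_le_gam (dist_le_le (leIr _ _) (xD k m km));
      by apply: gam_cons (leIr _ _) _; apply/esym; case: (yP k); case: (yP m).
  exists b; split=> //; have bc' : b <= ~` c by rewrite -disj_leC bc eqxx.
  apply: (@dist_le_gam _ _ _ _ _ _ x0 _ x0); last by apply: dist_le_refl; have := rad0 k; lra.
    by apply: gam_cons bc' _; case: (yP k).
  by apply: gam_cons bc' _; case: (yP m).
have [s sP] := seq_of y.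
have sC : ccauchy D s.
  (* Two terms past [K] are each within [3 * rad K] of [y K], hence the division by 6. *)
  apply: cauchy_of_rat => q q0; have [|K KP] := @pow2_small (q / 6%:R)%R.
    by lra.
  exists (nconst A K) => n m nn mm; apply: dist_le_force => b b0 _.
  have [i [b1 [b10 b1b b1i]]] := gval_force n b0.
  have [j [b2 [b20 b21 b2j]]] := gval_force m b10.
  have Ki : (K <= i)%N by apply: nconst_le nn b10 b1i.
  have Kj : (K <= j)%N by apply: nconst_le mm b20 b2j.
  exists b2; split=> //; first by chain.
  have rK : (rad K <= q / 6%:R)%R by apply: KP.
  apply: (@dist_le_gam _ _ _ _ _ _ (y i) _ (y j)); [| |].
  - by apply/esym/sP; chain.
  - exact/esym/sP.
  apply: dist_le_le (lex1 _) _.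
  by apply: dist_le_mono (dist_le_trans (dist_le_sym (yD K i Ki)) (yD K j Kj)); lra.
have [l sl] := cX s sC; have /csubsetP/(_ c l (inon_cfull _ _))/inon_cjoin := Ocover.
move=> /(csup_force c0)[b [e [[j jl] e0 ec eb]]].
have /copenP/(_ e l e0 (inon_le eb jl))[b1 [r [b10 b1e r0 H]]] := Oopen j.
have r2 : (0 < r / 2)%R by lra.
have [n0 n0P] := converges_dist_le sl r2; have [K KP] := pow2_small r2.
have [k0 [b2 [b20 b21 b2k]]] := gval_force n0 b10.
(* [k] is past the convergence threshold on [b2] and has [rad k <= r / 2], so the ball around [x k]
   lies within [r] of [l]: the single index [j] covers it, against [xbad]. *)
have nk := Nmax_val K b2k; set k := maxn k0 K in nk.
have lk : dist_le b2 (r / 2)%R l (x k).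
  have ln := n0P _ (@Nmax_ge _ A n0 (nconst A K)).
  apply: dist_le_gam (dist_le_le (lex1 _) ln) => //.
  rewrite (sP _ _ _ nk); apply: gam_cons (_ : b2 <= c) _; first by chain.
  by case: (yP k).
apply: (xbad k b2) => //; first by chain.
exists [set j]; split; first exact: finite_set1.
move=> z b3 b30 b32 kz; exists b3, j; split=> //; apply: H; first by chain.
have rk : (rad k <= r / 2)%R by apply: KP; apply: leq_maxr.
by apply: dist_le_mono (dist_le_trans (dist_le_le b32 lk) kz); lra.
Qed.

End HeineBorel.

Lemma complete_nets_compact d (A : completeBoolType d) (X : condSet A) (D : condMetric X) :
  ccomplete D -> finite_nets D -> ccompact D.
Proof.
move=> cX FC J O Oopen Ocover.
have [||I [a [pa /choice[F FP]]]] := @dense_part _ A (fun c => fin_on O c (fun _ _ => True)) \top.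
- by move=> b c bc; apply: fin_on_sub.
- by move=> c c0 _; apply: fin_on_dense Oopen Ocover _ cX FC c0.
exists I, a, F; split=> // i; have [Ff HF] := FP i; split=> //.
apply/csubsetP => b z /inon_crestr[bi bz]; apply/inon_cjoin/force_le => c c0 cb.
have [|e [j [e0 ec Fj ez]]] := HF z c c0 _ Logic.I; first by chain.
exists e => //; rewrite ec; apply: csup_ub; exists (exist _ j Fj).
apply/inon_cmeet; split=> //; apply/inon_crestr; split; first by chain.
exact: inon_cfull.
Qed.

(** * Compactness implies sequential compactness *)

Section ClusterPoints.
Context d (A : completeBoolType d) (X : condSet A) (D : condMetric X).
Variable s : condFun (condN A) X.
Implicit Types (a b c e : A) (x y z l : X \top) (p q r : rat) (k : nat)
  (n m : condN A \top).
Local Notation dist_le := (dist_le D).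
Local Notation nconst := (nconst A).

Definition cluster_on a l := forall q n b, (0 < q)%R -> b != \bot -> b <= a ->
  exists e m, [/\ e != \bot, e <= b, nle_on e n m & dist_le e q l (s m)].

(** Indices of close terms are found piecewise and glued to one conditional index [m]. *)
Lemma cluster_on_ccluster l : cluster_on \top l -> ccluster D s l.
Proof.
move=> lcl U [O [/copenP Oo Ol /csubsetP OU]] n.
have [||||m [nm mO]] := @dense_exists _ A (condN A)
    (fun a m => nle_on a n m /\ inon a (s m) O) \top.
- by move=> a c m ac [nm mO]; split; [apply: grel_on_le ac nm | apply: inon_le ac mO].
- move=> a m m' mm [nm mO]; split; first exact: grel_on_gam mm nm.
  by apply: inon_gam mO; apply: gam_capp.
- by move=> I c a m pa H; split; [apply: (grel_on_glue pa) | apply: (inon_glue pa)] => i;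
    case: (H i).
- move=> c c0 c1; have [b [r [b0 bc r0 H]]] := Oo _ _ c0 (inon_le c1 Ol).
  have [e [m [e0 eb nm lm]]] := lcl r n b r0 b0 (lex1 _).
  by exists e, m; split=> //; [chain | split=> //; apply: H].
by exists m; split=> //; apply: OU.
Qed.

Lemma cluster_on_exists :
  (forall c, c != \bot -> exists e l, [/\ e != \bot, e <= c & cluster_on e l]) ->
  exists l, ccluster D s l.
Proof.
move=> H; suff [l ll] : exists l, cluster_on \top l.
  by exists l; apply: cluster_on_ccluster.
apply: (@dense_exists _ A X cluster_on) => //.
- by move=> a c l ac lc q n b q0 b0 ba; apply: lc => //; chain.
- move=> a l l' ll la q n b q0 b0 ba; have [e [m [e0 eb nm lm]]] := la q n b q0 b0 ba.
  by exists e, m; split=> //; apply: dist_le_gam lm => //; apply: gam_cons ll; chain.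
- move=> I c a l pa la q n b q0 b0 bc; have [i [b' [b'0 b'b bi]]] := cpart_force pa b0 bc.
  have [e [m [e0 eb nm lm]]] := la i q n b' q0 b'0 bi.
  by exists e, m; split=> //; chain.
- by move=> c c0 _; apply: H.
Qed.

Section AwayFromTail.
Variable c : A.

(* Below c, the point z has positive distance from the tail of s starting at
   n; there is no condition outside c. *)
Definition away n a z := forall b, b != \bot -> b <= a -> b <= c ->
  exists e q, [/\ e != \bot, e <= b, (0 < q)%R &
    forall m e', e' != \bot -> e' <= e -> nle_on e' n m -> ~ dist_le e' q z (s m)].

Lemma away_le n a b z : a <= b -> away n b z -> away n a z.
Proof. by move=> ab H e e0 ea ec; apply: H => //; chain. Qed.

Lemma away_gam n a z z' : gam a z = gam a z' -> away n a z -> away n a z'.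
Proof.
move=> zz H b b0 ba bc; have [e [q [e0 eb q0 He]]] := H b b0 ba bc.
exists e, q; split=> // m e' e'0 e'e nm zm; apply: (He m e') => //.
by apply: dist_le_gam zm => //; apply: gam_cons (esym zz); chain.
Qed.

Lemma away_glue n (I : Type) b (a : I -> A) z : cpart b a ->
  (forall i, away n (a i) z) -> away n b z.
Proof.
move=> pa H e e0 eb ec; have [i [e1 [e10 e1e e1i]]] := cpart_force pa e0 eb.
have [|e2 [q [*]]] := H i e1 e10 e1i; first by chain.
by exists e2, q; split=> //; chain.
Qed.

Lemma away_gam_index n n' a z : gam a n = gam a n' -> away n a z -> away n' a z.
Proof.
move=> nn H b b0 ba bc; have [e [q [e0 eb q0 He]]] := H b b0 ba bc.
exists e, q; split=> // m e' e'0 e'e nm; apply: He => //.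
by apply: grel_on_gam nm => //; apply: gam_cons (esym nn); chain.
Qed.

Definition away_sub n : csub X := csub_of (@away_le n) (@away_gam n) (@away_glue n).

Lemma inon_away a n z : inon a z (away_sub n) <-> away n a z.
Proof. exact: inon_csub_of. Qed.

Definition away_pow n : powC X \top := exist _ (away_sub n) (lex1 _).

Lemma away_pow_gam a n n' : gam a n = gam a n' -> gam a (away_pow n) = gam a (away_pow n').
Proof.
move=> nn; apply/powC_gam_eq => b z ba /=.
have bnn : gam b n = gam b n' by apply: gam_cons nn.
by split=> /inon_away H; apply/inon_away; apply: away_gam_index H.
Qed.

Lemma away_open n : copen D (away_sub n).
Proof.
apply/copenP => a z a0 /inon_away az.
have [ac|ac] := eqVneq (a `&` c) \bot.
  exists a, 1%R; split=> // a' z' aa _; apply/inon_away => b b0 ba bc.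
  by move/negP: b0; case; rewrite -lex0 -ac lexI bc andbT; chain.
have [e [q [e0 ea q0 He]]] := az _ ac (leIl _ _) (leIr _ _).
exists e, (q / 2)%R; split=> //; [exact: le_trans ea (leIl _ _) | by lra |].
move=> a' z' a'e zz; apply/inon_away => b b0 ba bc.
exists b, (q / 2)%R; split=> //; first by lra.
move=> m e' e'0 e'b nm zm; apply: (He m e') => //; first by chain.
apply: dist_le_mono (dist_le_trans (dist_le_le _ zz) zm); [by lra | by chain].
Qed.

Hypothesis no_cluster : forall e l, e != \bot -> e <= c -> ~ cluster_on e l.

(** Below [c], failure of [cluster_on] at [z] yields a radius and an index past which no term comes
    close; where [c] is missed, any index works vacuously. *)
Lemma away_cover : csubset (cfull X) (cjoin away_sub).
Proof.
apply/csubsetP => a z _; apply/inon_cjoin/force_le => b b0 ba.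
have [bc|bc] := eqVneq (b `&` c) \bot.
  exists b => //; rewrite lexx; apply: csup_ub; exists (nconst 0); apply/inon_away.
  move=> e /negP e0 eb ec; case: e0; rewrite -lex0 -bc lexI eb ec //.
have := no_cluster (l := z) bc (leIr _ _).
move=> /existsNP[q /existsNP[n /existsNP[e /not_implyP[q0 /not_implyP[e0]]]]].
rewrite lexI => /not_implyP[/andP[eb ec] H].
exists e => //; rewrite eb; apply: csup_ub; exists n; apply/inon_away => e1 e10 e1e _.
exists e1, q; split=> // m e' e'0 e'1 nm zm; apply: H; exists e', m; split=> //.
by chain.
Qed.

End AwayFromTail.

(** Each of the finitely many indices becomes ordinary after one shrinking of the piece, and [K] is
    the maximum of their values. *)
Lemma finite_index_bound e (F : set (condN A \top)) : e != \bot -> finite_set F ->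
  exists b K, [/\ b != \bot, b <= e & forall n, F n -> nle_on b n (nconst K)].
Proof.
move=> e0 /(@finite_seqP {classic condN A \top})[t ->].
elim: t => [|n t [b [K [b0 be bK]]]]; first by exists e, 0%N; split.
have [k [b' [b'0 b'b b'k]]] := gval_force (n : condN A \top) b0.
exists b', (maxn k K); split=> //; first by chain.
move=> n'; rewrite /= inE => /orP[/eqP ->|/bK /grel_onP H].
  apply/grel_onP => c p q c0 cb cp /(gconst_val c0) ->.
  by rewrite (gval_uniq c0 cp (le_trans cb b'k)) leq_maxl.
apply/grel_onP => c p q c0 cb cp /(gconst_val c0) ->.
apply: leq_trans (leq_maxr _ _); apply: (H c) => //; [by chain | exact: gconst_le].
Qed.

End ClusterPoints.

Lemma compact_seq_compact d (A : completeBoolType d) (X : condSet A) (D : condMetric X) :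
  ccompact D -> cseq_compact D.
Proof.
move=> H s; apply: cluster_on_exists => c c0; apply: contrapT => N.
have nc e l : e != \bot -> e <= c -> ~ cluster_on D s e l.
  by move=> e0 ec el; apply: N; exists e, l.
pose O := condfun_of (@away_pow_gam _ A X D s c).
have OE n : sval (O n) = away_sub D s c n by rewrite /O condfun_ofE.
have OF : (fun j => sval (O j)) = away_sub D s c by apply/funext.
have [||I [a [F [pa FP]]]] := H _ O.
- by move=> n; rewrite OE; apply: away_open.
- by rewrite OF; apply: away_cover.
have [i [e [e0 ec ei]]] := cpart_force pa c0 (lex1 _).
have [Ff /csubsetP Fc] := FP i; have [b [K [b0 be bK]]] := finite_index_bound e0 Ff.
have /Fc/inon_cjoin : inon b (s (nconst A K)) (crestr (a i) (cfull X)).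
  by apply/inon_crestr; split; [chain | apply: inon_cfull].
move=> /(csup_force b0)[f [g [[[n Fn] /inon_cmeet[fn _]] g0 gb gf]]].
move: fn; rewrite OE => /inon_away/(away_le gf)/(_ g g0 (lexx _))[|h [q [h0 hg q0]]].
  by chain.
(* The term with index [K] lies in the tail from [n] on this piece, so it cannot be away from that
   tail: its distance to itself is zero. *)
move=> /(_ (nconst A K) h h0 (lexx _)); case; last by apply: dist_le_refl; apply: ltW.
by apply: grel_on_le (bK _ Fn); chain.
Qed.

Theorem theorem4p8 (disp : Order.disp_t) (A : completeBoolType disp)
    (X : condSet A) (D : condMetric X) :
  (ccompact D <-> (ccomplete D /\ ctotally_bounded D)) /\
  ((ccomplete D /\ ctotally_bounded D) <-> cseq_compact D).
Proof.
have i_iii := @compact_seq_compact _ A X D.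
have iii_ii : cseq_compact D -> ccomplete D /\ ctotally_bounded D.
  move=> H; split; first exact: seq_compact_complete.
  exact/nets_totally_bounded/seq_compact_nets.
have ii_i : ccomplete D /\ ctotally_bounded D -> ccompact D.
  by move=> [cX /totally_bounded_nets]; apply: complete_nets_compact.
by split; [split=> [/i_iii/iii_ii|/ii_i] | split=> [/ii_i/i_iii|/iii_ii]].
Qed.
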